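(* Consider a blockwise group-floor bandit with $K$ arms, rewards in $[0,1]$, horizon $T=\sum_{b=1}^BH_b$, pairwise disjoint groups $\mathcal G$ and integer group floors $f_{b,g}\ge0$ such that every block satisfies $\sum_g f_{b,g}\le H_b$. Let $\eta\in(0,1)$ and $L=\log(2KT/\eta)$. Then D-BDQ-UCB meets every group floor in every block deterministically (its covering pulls provide exactly $f_{b,g}$ pulls for group $g$ in block $b$), and with probability at least $1-\eta$ its realized mean value $V=\sum_{t=1}^T\mu_{A_t}$ satisfies $$\mathrm{OPT}^{\mathrm{frac}}-V\ \le\ 4K+4\sqrt{2L}\Bigl(\sum_{g\in\mathcal G}\sqrt{|g|F_g}+\sqrt{KR'}\Bigr)\ \le\ 4K+8\sqrt{KTL},$$ where $F_g=\sum_b f_{b,g}$ is the group's total floor and $R'=T-\sum_gF_g$ is the total surplus. Moreover, on instances with $K=2B+1$ arms, $B$ blocks of even length $H$, $B$ disjoint groups of size two, and in block $b$ a floor $H/2$ on the $b$-th group only, the bound is $O(\sqrt L\cdot B\sqrt H)$, which matches up to $\sqrt L$ the lower bound $\sup[\mathrm{OPT}^{\mathrm{frac}}-\mathbb E V^\pi]\ge c\,B\sqrt H$ ($c>0$ universal) that holds on a family of such instances for every blockwise-group-fair policy $\pi$. When all groups are singletons, $\mathrm{OPT}^{\mathrm{frac}}$ coincides with the value of the comparator that executes the floors and gives all surplus rounds to a best arm, and the guarantee $\mathrm{OPT}^{\mathrm{frac}}-V\le K+4\sqrt{2KR'L}$ with probability at least $1-\eta$ is recovered.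
   Context: Bandit: arm $i\in[K]$ produces independent rewards in $[0,1]$ with mean $\mu_i$ (i.i.d. within an arm); $\mu_\star=\max_i\mu_i$; $A_t$ is the arm pulled at round $t$. Group floors: the horizon is partitioned into $B$ consecutive blocks, block $b$ of length $H_b$; $\mathcal G$ is a collection of nonempty subsets of $[K]$; block $b$ requires that each group $g$ receive at least $f_{b,g}$ pulls in aggregate, $\sum_{i\in g}N_{b,i}\ge f_{b,g}$, where $N_{b,i}$ is the number of pulls of arm $i$ in block $b$. A policy is blockwise-group-fair if this always holds for all $b,g$. The fractional optimum is $\mathrm{OPT}^{\mathrm{frac}}=\sum_b V_b^{\mathrm{frac}}$ with $V_b^{\mathrm{frac}}=\max\{\sum_i\mu_iy_i: y\ge0,\ \sum_{i\in g}y_i\ge f_{b,g}\ \forall g\in\mathcal G,\ \sum_iy_i=H_b\}$. D-BDQ-UCB: with indices $U_i=+\infty$ if arm $i$ has no observation and $U_i=\widehat\mu_i+\sqrt{2L/N_i}$ otherwise ($N_i,\widehat\mu_i$ = pull count and empirical mean of arm $i$ from all observations so far, updated after every pull), in each block $b$ it executes, for every group $g$, exactly $f_{b,g}$ covering pulls, each selecting an arm in $\arg\max_{i\in g}U_i$, and then spends each of the surplus $H_b-\sum_gf_{b,g}$ rounds on an arm in $\arg\max_{i\in[K]}U_i$. *)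

(* Defs.v *)
(* MathComp-Analysis, over an arbitrary [R : realType]. *)
From HB Require Import structures.
From mathcomp Require Import all_boot all_order all_algebra.
From mathcomp Require Import all_classical all_reals all_analysis.

Set Implicit Arguments.
Unset Strict Implicit.
Unset Printing Implicit Defensive.

Import Order.TTheory GRing.Theory Num.Theory.
Import numFieldNormedType.Exports.

Local Open Scope classical_set_scope.
Local Open Scope ring_scope.

Definition mutually_independent d (Omega : measurableType d) (R : realType)
    (P : probability Omega R) (I : finType) (X : I -> {RV P >-> R}) : Prop :=
  forall (J : {set I}) (E : I -> set R), (forall i, measurable (E i)) ->
  (P (\bigcap_(i in [set` J]) (X i @^-1` E i)) =
   \prod_(i in J) P (X i @^-1` E i))%E.

(* A stochastic bandit with arms ['I_K] and horizon [T]: [reward i n] is the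
   reward revealed by pull number [n] (counted from 0) of arm [i]. Independence
   is only asked of the entries [n < T], the only ones observable within the
   horizon. *)
Record bandit (R : realType) (K T : nat) := Bandit {
  bandit_disp : measure_display;
  outcome : measurableType bandit_disp;
  law : probability outcome R;
  reward : 'I_K -> nat -> {RV law >-> R};
  mean : 'I_K -> R;
  reward_unit : forall i n w, 0 <= reward i n w <= 1;
  reward_mean : forall i n, ('E_law[reward i n] = (mean i)%:E)%E;
  reward_ident : forall i m n (A : set R), measurable A ->
    distribution law (reward i m) A = distribution law (reward i n) A;
  reward_indep :
    mutually_independent (fun p : 'I_K * 'I_T => reward p.1 p.2) }.

(* A possibly randomized policy: [seed] carries the internal randomness, and
   [act u h] is the arm pulled after the history [h], the sequence of (arm,
   observed reward) pairs of the past rounds, oldest first. *)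
Record policy (R : realType) (K : nat) := Policy {
  policy_disp : measure_display;
  seed : measurableType policy_disp;
  seed_law : probability seed R;
  act : seed -> seq ('I_K * R) -> 'I_K;
  act_measurable : forall n (a : n.-tuple 'I_K) (i : 'I_K),
    measurable [set z : seed * n.-tuple R | act z.1 (zip a z.2) = i] }.

Section histories.
Variables (R : realType) (K : nat).
Implicit Types (h : seq ('I_K * R)) (i : 'I_K).

Definition npulls h i : nat := count (fun p => p.1 == i) h.

Definition empirical_mean h i : R :=
  (\sum_(p <- h | p.1 == i) p.2) / (npulls h i)%:R.

Definition ucb (L : R) h i : \bar R :=
  if npulls h i == 0%N then +oo%E
  else (empirical_mean h i + Num.sqrt (2 * L / (npulls h i)%:R))%:E.

Definition is_argmax (A : {set 'I_K}) (U : 'I_K -> \bar R) i : Prop :=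
  i \in A /\ forall j, j \in A -> (U j <= U i)%E.

Variable pi : policy R K.

(* History after [t] rounds when pull number [n] of arm [i] yields [x i n]. *)
Fixpoint history (u : seed pi) (x : 'I_K -> nat -> R) (t : nat)
    : seq ('I_K * R) :=
  if t is t'.+1 then
    let h := history u x t' in
    let i := act u h in
    rcons h (i, x i (npulls h i))
  else [::].

Definition arm u x t : 'I_K := act u (history u x t).

Definition realized_value (mu : 'I_K -> R) (T : nat) u x : R :=
  \sum_(t < T) mu (arm u x t).

End histories.

Definition unit_table (R : realType) (K : nat) (x : 'I_K -> nat -> R) : Prop :=
  forall i n, 0 <= x i n <= 1.

Section run.
Variables (R : realType) (K T : nat).
Variables (M : bandit R K T) (pi : policy R K).

(* The policy's randomness is independent of the rewards. *)
Definition run_law : probability (outcome M * seed pi)%type R :=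
  (law M \x seed_law pi)%E.

Definition run_value (z : outcome M * seed pi) : R :=
  realized_value (mean M) T z.2 (fun i n => reward M i n z.1).

End run.

Section blocks.
Variables (K B : nat) (H : 'I_B -> nat).
Variables (G : {set {set 'I_K}}) (f : 'I_B -> {set 'I_K} -> nat).

Definition horizon : nat := (\sum_(b < B) H b)%N.

Definition block_start (b : 'I_B) : nat := (\sum_(c < B | (c < b)%N) H c)%N.

Definition in_block (b : 'I_B) (t : nat) : bool :=
  (block_start b <= t < block_start b + H b)%N.

(* Number of rounds [t] of block [b] with [p t]. *)
Definition block_count (b : 'I_B) (p : pred nat) : nat :=
  #|[pred t : 'I_horizon | in_block b t && p t]|.

Definition total_floor (g : {set 'I_K}) : nat := (\sum_(b < B) f b g)%N.

Definition block_surplus (b : 'I_B) : nat := (H b - \sum_(g in G) f b g)%N.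

(* Truncated subtraction; exact when the floors of a block fit in it. *)
Definition total_surplus : nat := (horizon - \sum_(g in G) total_floor g)%N.

Variable R : realType.

Definition group_fair (pi : policy R K) : Prop :=
  forall u x, unit_table x -> forall b g, g \in G ->
  (f b g <= \sum_(i in g) block_count b (fun t => arm (pi := pi) u x t == i))%N.

Section optimum.
Variable mu : 'I_K -> R.

Definition feasible (b : 'I_B) (y : 'I_K -> R) : Prop :=
  [/\ forall i, 0 <= y i,
      forall g, g \in G -> (f b g)%:R <= \sum_(i in g) y i
    & \sum_(i < K) y i = (H b)%:R].

(* The maximum of a linear form over a compact polytope, as a supremum. *)
Definition block_opt (b : 'I_B) : R :=
  sup [set \sum_(i < K) mu i * y i | y in feasible b].

Definition opt_frac : R := \sum_(b < B) block_opt b.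

(* Pulls of arm [i] in block [b] by the comparator that, for singleton groups,
   executes the floors and gives every surplus round to the arm [istar]. *)
Definition comparator_pulls (istar : 'I_K) (b : 'I_B) (i : 'I_K) : nat :=
  ((if [set i]%SET \in G then f b [set i]%SET else 0)
   + (if i == istar then block_surplus b else 0))%N.

Definition comparator_value (istar : 'I_K) : R :=
  \sum_(b < B) \sum_(i < K) mu i * (comparator_pulls istar b i)%:R.

End optimum.

(* [s t = Some g] marks round [t] as a covering pull for [g], [s t = None] as a
   surplus round. The order of the covering pulls of a block is unconstrained. *)
Definition valid_schedule (s : nat -> option {set 'I_K}) : Prop :=
  [/\ forall t g, (t < horizon)%N -> s t = Some g -> g \in G,
      forall b g, g \in G -> block_count b (fun t => s t == Some g) = f b g
    & forall b t t', in_block b t -> in_block b t' -> (t < t')%N ->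
        s t = None -> s t' = None].

(* Ties in the argmax are broken arbitrarily, possibly at random. *)
Definition dbdq_ucb (L : R) (s : nat -> option {set 'I_K}) (pi : policy R K)
    : Prop :=
  valid_schedule s /\
  forall u x, unit_table x -> forall t, (t < horizon)%N ->
  is_argmax (if s t is Some g then g else [set: 'I_K]%SET)
    (ucb L (history (pi := pi) u x t)) (arm (pi := pi) u x t).

Definition conf (eta : R) : R := ln (2 * K%:R * horizon%:R / eta).

Definition group_bound (L : R) : R :=
  4 * K%:R + 4 * Num.sqrt (2 * L) *
    (\sum_(g in G) Num.sqrt (#|g|%:R * (total_floor g)%:R)
     + Num.sqrt (K%:R * total_surplus%:R)).

Definition coarse_bound (L : R) : R :=
  4 * K%:R + 8 * Num.sqrt (K%:R * horizon%:R * L).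

Definition singleton_bound (L : R) : R :=
  K%:R + 4 * Num.sqrt (2 * K%:R * total_surplus%:R * L).

End blocks.

(* [grp] enumerates [B] disjoint groups of size two among [2 * B + 1] arms;
   block [b] has the floor [h / 2] on [grp b] and no other floor. *)
Definition paired_layout (B h : nat) (grp : 'I_B -> {set 'I_(2 * B + 1)})
    (G : {set {set 'I_(2 * B + 1)}})
    (f : 'I_B -> {set 'I_(2 * B + 1)} -> nat) : Prop :=
  [/\ injective grp, G = [set grp b | b : 'I_B]%SET, finset.trivIset G,
      forall b, #|grp b| = 2
    & forall b g, f b g = if g == grp b then h./2 else 0%N].

(* Main.v *)
(** Upper bound. Rewards lie within distance [1] of their mean, so
    [cosh l <= exp (l ^ 2 / 2)] and independence give the tail [2 exp (- L)] for
    the event that an empirical mean of [n] rewards misses its target by more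
    than [sqrt (2 L / n)]; with [L = log (2 K T / eta)] a union bound over the
    [K T] pairs (arm, [n]) leaves probability [1 - eta]. On that event a pull of
    an arm already pulled [n >= 1] times loses at most [2 sqrt (2 L / n)] against
    the best arm of its context (a group, or all arms for a surplus round), and
    the fractional optimum is at most the sum of these benchmarks. Summing
    [1 / sqrt n] and applying Cauchy-Schwarz within each context, then across
    contexts, gives both bounds.

    Lower bound. Outside arms have mean [1] and the two arms of each group have
    means [1 / 2 + eps] and [1 / 2 - eps] in an order given by a sign per group,
    with [eps = 1 / (4 sqrt (h / 2))]. Only the first [h / 2] pulls of a group
    matter: they are forced by the floor, each wrong one costs [2 eps], and they
    reveal at most [h / 2] rewards of each of the two arms, so that the laws of
    what they reveal under the two signs have Hellinger affinity at least
    [3 / 4]. Averaging over the signs gives an instance with regret of order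
    [B sqrt h]. *)

Require Import Defs.
From HB Require Import structures.
From mathcomp Require Import all_boot all_order all_algebra.
From mathcomp Require Import all_classical all_reals all_analysis.
From mathcomp Require Import finmap measurable_realfun ring lra zify.

Set Implicit Arguments.
Unset Strict Implicit.
Unset Printing Implicit Defensive.

Import Order.TTheory GRing.Theory Num.Theory.
Import numFieldNormedType.Exports.
Local Open Scope classical_set_scope.
Local Open Scope ring_scope.

(** * Independence *)

Section independence.
Import HBNNSimple.
Context d (T : measurableType d) (R : realType) (P : probability T R).

(** Both sides are linear in [f] and pass to increasing limits, so agreement on indicators extends
    to simple functions and then, by monotone convergence, to [f]. Taking [E = setT] shows that [c]
    is the integral of [g]. *)
Lemma integral_mul_comp_indep (X : {RV P >-> R}) (g : T -> R) (c : R)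
    (f : R -> R) :
  measurable_fun setT g -> (forall w, 0 <= g w) ->
  (forall E : set R, measurable E ->
    \int[P]_w (g w * \1_E (X w))%:E = c%:E * \int[P]_w (\1_E (X w))%:E)%E ->
  measurable_fun [set: R] f -> (forall x, 0 <= f x) ->
  (\int[P]_w (g w * f (X w))%:E = c%:E * \int[P]_w (f (X w))%:E)%E.
Proof.
move=> mg g0 gE mf f0.
pose fE : R -> \bar R := EFin \o f.
have mEf : measurable_fun [set: R] fE.
  exact/measurable_EFinP.
have f0' (x : R) : [set: R] x -> (0 <= fE x)%E by rewrite lee_fin.
pose f_ := nnsfun_approx measurableT mEf.
have cvf x : (f_ n x)%:E @[n --> \oo] --> (f x)%:E.
  exact: (cvg_nnsfun_approx measurableT mEf f0').
have mfX n : measurable_fun setT (fun w => f_ n (X w)).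
  exact: measurableT_comp.
have c0 : 0 <= c.
  have := gE setT measurableT.
  rewrite [X in (_ * X)%E](_ : _ = 1%E); last first.
    under eq_integral do rewrite indicT /=.
    by rewrite integral_cst// mul1e; exact: probability_setT.
  rewrite mule1 -lee_fin => <-.
  by apply: integral_ge0 => w _; rewrite lee_fin mulr_ge0.
have simple n : (\int[P]_w (g w * f_ n (X w))%:E =
    c%:E * \int[P]_w (f_ n (X w))%:E)%E.
  have f_E := fimfunEord (f_ n).
  set s := fset_set _ in f_E.
  have s0 (i : 'I_(#|` s|)) : 0 <= s`_ i.
    have : s`_ i \in s by rewrite mem_nth.
    rewrite in_fset_set//.
    by move=> /set_mem[x _ <-]; exact: fun_ge0.
  have mE (i : 'I_(#|` s|)) : measurable (f_ n @^-1` [set s`_ i]).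
    exact: measurable_sfunP.
  have mI (i : 'I_(#|` s|)) :
      measurable_fun setT (fun w => \1_(f_ n @^-1` [set s`_ i]) (X w) : R).
    exact: measurableT_comp.
  under eq_integral => w _.
    rewrite f_E mulr_sumr -sumEFin.
    under eq_bigr do rewrite mulrCA EFinM.
    over.
  under [X in (_ * X)%E]eq_integral => w _.
    rewrite f_E -sumEFin.
    under eq_bigr do rewrite EFinM.
    over.
  rewrite !ge0_integral_sum//; last 4 first.
  - by move=> i; apply/measurable_EFinP; exact: measurable_funM.
  - by move=> i w _; rewrite lee_fin mulr_ge0.
  - move=> i; apply/measurable_EFinP; apply: measurable_funM => //.
    exact: measurable_funM.
  - by move=> i w _; rewrite lee_fin !mulr_ge0.
  rewrite ge0_sume_distrr; last first.
    by move=> i _; apply: integral_ge0 => w _; rewrite lee_fin mulr_ge0.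
  apply: eq_bigr => i _.
  rewrite !ge0_integralZl//; last first.
  - by rewrite lee_fin.
  - by move=> w _; rewrite lee_fin mulr_ge0.
  - by apply/measurable_EFinP; exact: measurable_funM.
  - by rewrite lee_fin.
  - exact/measurable_EFinP.
  by rewrite gE// muleCA.
transitivity (limn (fun n => \int[P]_w (g w * f_ n (X w))%:E))%E.
  rewrite -monotone_convergence//.
  - apply: eq_integral => w _; apply/esym/cvg_lim => //.
    under eq_fun do rewrite EFinM.
    by rewrite EFinM; apply: cvgeZl.
  - by move=> n; apply/measurable_EFinP; exact: measurable_funM.
  - by move=> n w _; rewrite lee_fin mulr_ge0.
  - move=> w _ m n mn; rewrite lee_fin ler_wpM2l//.
    exact/lefP/nd_nnsfun_approx.
apply/cvg_lim => //.
under eq_fun do rewrite simple.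
have cv : (\int[P]_w (f_ n (X w))%:E @[n --> \oo] --> \int[P]_w (f (X w))%:E)%E.
  rewrite [X in _ --> X](_ : _ = \int[P]_w limn (fun n => (f_ n (X w))%:E))%E.
    apply: cvg_monotone_convergence => //.
    - by move=> n; exact/measurable_EFinP.
    - by move=> n w _; rewrite lee_fin.
    - by move=> w _ m n mn; rewrite lee_fin; exact/lefP/nd_nnsfun_approx.
  by apply: eq_integral => w _; apply/esym/cvg_lim.
exact: cvgeZl.
Qed.

(* Induction on the number of factors [f i] that are not indicators. *)
Lemma expectation_prod_indep (J : finType) (X : J -> {RV P >-> R})
    (f : J -> R -> R) :
  mutually_independent X ->
  (forall i, measurable_fun [set: R] (f i)) -> (forall i x, 0 <= f i x) ->
  (forall i, \int[P]_w (f i (X i w))%:E \is a fin_num)%E ->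
  (\int[P]_w (\prod_i f i (X i w))%:E = \prod_i \int[P]_w (f i (X i w))%:E)%E.
Proof.
move=> indX.
suff main n : forall f : J -> R -> R,
    (forall i, measurable_fun [set: R] (f i)) -> (forall i x, 0 <= f i x) ->
    (forall i, \int[P]_w (f i (X i w))%:E \is a fin_num)%E ->
    forall A : {set J}, #|A| = n ->
    (forall i, i \notin A -> exists2 E, measurable E & f i = \1_E) ->
    (\int[P]_w (\prod_i f i (X i w))%:E =
     \prod_i \int[P]_w (f i (X i w))%:E)%E.
  by move=> mf f0 ffin; apply: (main _ f mf f0 ffin [set: J]%SET erefl) => i;
    rewrite finset.in_setT.
elim: n => [|n IH] {}f mf f0 ffin A.
  move=> /cards0_eq -> fE.
  have /choice[E mfE] : forall i, exists E, measurable E /\ f i = \1_E.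
    by move=> i; have [|E mE ->] := fE i; [rewrite inE|exists E].
  have mE i : measurable (E i) by case: (mfE i).
  have {mfE}fEi i : f i = \1_(E i) by case: (mfE i).
  have mX i : measurable (X i @^-1` E i) by exact: measurable_sfunP.
  have := indX [set: J]%SET E mE.
  rewrite (_ : \bigcap_(i in _) _ = \bigcap_i (X i @^-1` E i)); last first.
    by apply: eq_bigcapl; split => i _ //=; rewrite inE.
  move=> indE.
  transitivity (\int[P]_w (\1_(\bigcap_i (X i @^-1` E i)) w)%:E)%E.
    apply: eq_integral => w _; congr EFin.
    rewrite indicE; have [wE|wE] := boolP (w \in _).
      rewrite big1// => i _; rewrite fEi indicE mem_set//.
      by move/set_mem : wE => /(_ i I).
    have [i Ei] : exists i, ~ E i (X i w).
      apply/existsNP => Ew; move/negP : wE; apply.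
      by apply/mem_set => i _; exact: Ew.
    rewrite (bigD1 i)//= fEi indicE memNset ?mul0r//.
  rewrite integral_indic//; last first.
    by apply: fin_bigcap_measurable => //; exact: finite_finset.
  rewrite setIT; apply: (etrans indE).
  under eq_bigl do rewrite inE.
  apply: eq_bigr => i _.
  by rewrite fEi -[in LHS](setIT (_ @^-1` _)) -integral_indic.
move=> An fE.
have /card_gt0P[a aA] : (0 < #|A|)%N by rewrite An.
have fgE : forall g : R -> R, (\int[P]_w (\prod_i
    (if i == a then g else f i) (X i w))%:E =
    \int[P]_w ((\prod_(i | i != a) f i (X i w)) * g (X a w))%:E)%E.
  move=> g; apply: eq_integral => w _; congr EFin.
  rewrite (bigD1 a)//= eqxx mulrC; congr (_ * _).
  by apply: eq_bigr => i /negPf ->.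
have := fgE (f a).
under eq_integral => w _.
  under eq_bigr => i _.
    rewrite (_ : (if i == a then f a else f i) = f i); last by case: eqP => [->|].
    over.
  over.
move=> ->.
have cfin : (\prod_(i | i != a) \int[P]_w (f i (X i w))%:E)%E \is a fin_num.
  by elim/big_ind : _ => // x y; exact: fin_numM.
rewrite [RHS](bigD1 a)//= muleC -(fineK cfin).
apply: (@integral_mul_comp_indep (X a)) => //.
- under eq_fun do rewrite -big_filter; apply: measurable_prod => i _.
  by apply: measurableT_comp => //; exact: measurable_funP.
- by move=> w; exact: prodr_ge0.
move=> E mE; rewrite -fgE fineK//.
rewrite (IH (fun i => if i == a then \1_E else f i) _ _ _ (A :\ a)%SET); first last.
- by move=> i; rewrite !inE; case: eqVneq => [_ _|_ /= /fE//]; exists E.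
- by move: An; rewrite (cardsD1 a) aA => -[].
- move=> i; case: eqVneq => // _.
  rewrite integral_indic//; last exact: measurable_sfunP.
  by rewrite setIT fin_num_measure//; exact: measurable_sfunP.
- by move=> i x; case: eqVneq => // _; rewrite indicE.
- by move=> i; case: eqVneq.
rewrite (bigD1 a)//= eqxx muleC; congr (_ * _)%E.
by apply: eq_bigr => i /negPf ->.
Qed.

End independence.

(** * Exponential inequalities behind the sub-Gaussian bound *)

Section exponential_bounds.
Variable R : realType.
Implicit Types (x y l : R).

(** Compares the coefficients of [x ^ (2 n)] in [cosh x] and in [exp (x ^ 2 / 2)]. *)
Lemma leq_expn2_fact n : (2 ^ n * n`! <= n.*2`!)%N.
Proof.
elim: n => // n IH; rewrite doubleS !factS expnS.
have -> : (2 * 2 ^ n * (n.+1 * n`!) = (n.*2.+2) * (2 ^ n * n`!))%N by lia.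
rewrite leq_mul2l; apply/orP; right; apply: (leq_trans IH).
by rewrite leq_pmull.
Qed.

(** Odd powers cancel in the sum of the two series, and the even ones are compared term by term
    through [leq_expn2_fact]. *)
Lemma expR_add_expRN_le x : expR x + expR (- x) <= 2 * expR (x ^+ 2 / 2).
Proof.
set y := x ^+ 2 / 2.
have y0 : 0 <= y by rewrite divr_ge0 ?sqr_ge0.
have cx := is_cvg_series_exp_coeff x; have cNx := is_cvg_series_exp_coeff (- x).
(* [uphalf n] is the number of even indices below [n], the only ones that survive on the left. *)
have main n : series (exp_coeff x) n + series (exp_coeff (- x)) n <=
    2 * series (exp_coeff y) (uphalf n).
  elim: n => [|n IH]; first by rewrite /series /= !big_geq// mulr0 addr0.
  rewrite /series /= in IH *; rewrite !big_nat_recr //= addrACA.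
  have [no|ne] := boolP (odd n).
    rewrite (_ : _ + _ / _ = 0) ?addr0; last first.
      by rewrite exprNn -signr_odd no expr1 mulN1r mulNr subrr.
    by move: IH; rewrite uphalf_half no add1n big_nat_recr.
  move: IH; rewrite uphalf_half (negPf ne) add0n => IH.
  rewrite mulrDr lerD// /exp_coeff /= exprNn -signr_odd (negPf ne) expr0 mul1r.
  rewrite -mulr2n -[leLHS]mulr_natl ler_pM2l//.
  have nE : n = (n./2).*2 by rewrite even_halfK// ne.
  rewrite {1 2}nE -mul2n exprM /y expr_div_n -mulrA.
  rewrite ler_wpM2l ?(exprn_ge0 _ (sqr_ge0 x))//.
  rewrite -invfM lef_pV2 ?posrE ?mulr_gt0 ?exprn_gt0 ?ltr0n ?fact_gt0//.
  by rewrite -natrX -natrM ler_nat mul2n leq_expn2_fact.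
have -> : expR x + expR (- x) =
    limn (series (exp_coeff x) \+ series (exp_coeff (- x))).
  by rewrite limD.
apply: limr_le; first exact: is_cvgD.
near=> n; apply: (le_trans (main n)); rewrite ler_pM2l//.
apply: nondecreasing_cvgn_le; last exact: is_cvg_series_exp_coeff.
apply/nondecreasing_seqP => k.
by rewrite /series /= big_nat_recr//= lerDl exp_coeff_ge0.
Unshelve. all: by end_near. Qed.

(** Convexity: the right-hand side is the chord over [[-1, 1]]. The tangent inequality at [l * y] is
    read at [l] and at [- l], then averaged with weights [(1 + y) / 2] and [(1 - y) / 2]. *)
Lemma expR_le_chord l y : -1 <= y <= 1 ->
  expR (l * y) <= (expR l + expR (- l)) / 2 + (expR l - expR (- l)) / 2 * y.
Proof.
move=> /andP[yN1 y1].
have tangent (s : R) : expR (l * y) * (1 + (s - l * y)) <= expR s.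
  have -> : expR s = expR (l * y) * expR (s - l * y).
    by rewrite -expRD addrC subrK.
  by rewrite ler_wpM2l ?expR_ge0// expR_ge1Dx.
have := ler_wpM2l (_ : 0 <= (1 + y) / 2) (tangent l).
have := ler_wpM2l (_ : 0 <= (1 - y) / 2) (tangent (- l)).
move=> /(_ ltac:(lra)) h1 /(_ ltac:(lra)) h2.
nra.
Qed.

End exponential_bounds.

(** * Hoeffding's inequality *)

Section hoeffding.
Context d (T : measurableType d) (R : realType) (P : probability T R).

Lemma unit_integrable (X : {RV P >-> R}) :
  (forall w, 0 <= X w <= 1) -> P.-integrable setT (EFin \o X).
Proof.
move=> X01; have i1 := finite_measure_integrable_cst P 1 measurableT.
apply: (le_integrable measurableT _ _ i1) => //.
  exact/measurable_EFinP.
move=> w _ /=; rewrite lee_fin normr1 ger0_norm; last by case/andP: (X01 w).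
by case/andP: (X01 w).
Qed.

Lemma unit_expectation_bounds (X : {RV P >-> R}) (mu : R) :
  (forall w, 0 <= X w <= 1) -> ('E_P[X] = mu%:E)%E -> 0 <= mu <= 1.
Proof.
move=> X01 EX; apply/andP; split; rewrite -lee_fin -EX.
  by apply: expectation_ge0 => w; case/andP: (X01 w).
rewrite -(expectation_cst P 1); apply: expectation_le => //.
- by move=> w; case/andP: (X01 w).
- by apply/aeW => w; case/andP: (X01 w).
Qed.

(** [X - mu] is centred with values in [[-1, 1]], so the linear part of the chord integrates to zero
    and only [cosh l] remains. *)
Lemma unit_mgf_le (X : {RV P >-> R}) (mu l : R) :
  (forall w, 0 <= X w <= 1) -> ('E_P[X] = mu%:E)%E ->
  (\int[P]_w (expR (l * (X w - mu)))%:E <= (expR (l ^+ 2 / 2))%:E)%E.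
Proof.
move=> X01 EX; have /andP[mu0 mu1] := unit_expectation_bounds X01 EX.
set a := (expR l + expR (- l)) / 2; set b := (expR l - expR (- l)) / 2.
have chord w : expR (l * (X w - mu)) <= a - b * mu + b * X w.
  have /andP[X0 X1] := X01 w.
  apply: le_trans (expR_le_chord l _) _; last by rewrite -/a -/b mulrBr; lra.
  by apply/andP; split; lra.
apply: (@le_trans _ _ (\int[P]_w (a - b * mu + b * X w)%:E)%E).
  apply: ge0_le_integral => //.
  - apply/measurable_EFinP; apply: measurableT_comp => //.
    by apply: measurable_funM => //; exact: measurable_funB.
  - by apply/measurable_EFinP; apply: measurable_funD => //; exact: measurable_funM.
  - by move=> w _; rewrite lee_fin.
under eq_integral do rewrite EFinD EFinM.
have iX := unit_integrable X01.
rewrite integralD//; last 2 first.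
- exact: finite_measure_integrable_cst.
- exact: integrableZl.
rewrite integralZl// integral_cst// [X in (_ * X)%E]probability_setT mule1.
move: EX; rewrite unlock => ->.
rewrite -EFinM -EFinD lee_fin subrK.
by have := expR_add_expRN_le l; rewrite /a; lra.
Qed.

Variables (J : finType) (X : J -> {RV P >-> R}) (mu L : R) (S : {set J}).
Hypothesis indX : mutually_independent X.
Hypothesis X01 : forall j w, 0 <= X j w <= 1.
Hypothesis EX : forall j, j \in S -> ('E_P[X j] = mu%:E)%E.
Hypothesis L0 : 0 < L.
Hypothesis S0 : (0 < #|S|)%N.

Let n : R := #|S|%:R.
Let dev w := \sum_(j in S) (X j w - mu).

Lemma measurable_deviation : measurable_fun setT dev.
Proof.
rewrite /dev; under eq_fun do rewrite -big_filter.
by apply: measurable_sum => j; exact: measurable_funB.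
Qed.

Lemma deviation_mgf_le (l : R) :
  (\int[P]_w (expR (l * dev w))%:E <= (expR (l ^+ 2 / 2 * n))%:E)%E.
Proof.
(* Indices outside [S] get the factor 1, so that the product runs over all of [J] as in
   [expectation_prod_indep]. *)
pose f j (x : R) := if j \in S then expR (l * (x - mu)) else 1.
have f0 j x : 0 <= f j x by rewrite /f; case: ifP => // _; exact: expR_ge0.
have intf j : (\int[P]_w (f j (X j w))%:E <=
    (if j \in S then expR (l ^+ 2 / 2) else 1)%:E)%E.
  rewrite /f; case: ifPn => jS; first exact: unit_mgf_le (EX jS).
  by rewrite integral_cst// [X in (_ * X)%E]probability_setT mule1.
have -> : (\int[P]_w (expR (l * dev w))%:E =
    \int[P]_w (\prod_j f j (X j w))%:E)%E.
  apply: eq_integral => w _; rewrite /dev mulr_sumr expR_sum.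
  by rewrite [in LHS]big_mkcond.
rewrite (expectation_prod_indep (f := f))//; last 2 first.
- move=> j; rewrite /f; case: (j \in S) => //; apply: measurableT_comp => //.
  by apply: measurable_funM => //; exact: measurable_funB.
- move=> j; rewrite ge0_fin_numE ?(le_lt_trans (intf j)) ?ltry//.
  by apply: integral_ge0 => w _; rewrite lee_fin.
apply: (@le_trans _ _ (\prod_j (if j \in S then expR (l ^+ 2 / 2) else 1)%:E)%E).
  suff : (0 <= \prod_i \int[P]_w (f i (X i w))%:E <=
      \prod_j (if j \in S then expR (l ^+ 2 / 2) else 1)%:E)%E by case/andP.
  elim/big_ind2 : _ => [|x y x' y' /andP[x0 xy] /andP[x'0 xy']|j _].
  - by rewrite lee01 lexx.
  - by rewrite mule_ge0//= lee_pmul.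
  - by rewrite intf andbT; apply: integral_ge0 => w _; rewrite lee_fin.
rewrite prodEFin lee_fin -big_mkcond /= prodr_const -expRM_natl.
by rewrite mulrC.
Qed.

(** The sign [s] lets one Chernoff argument serve both tails. *)
Lemma deviation_tail_le (s : R) : s ^+ 2 = 1 ->
  (P [set w | Num.sqrt (2 * L * n) <= s * dev w]%R <= (expR (- L))%:E)%E.
Proof.
move=> s2; pose Y w := s * dev w.
have mY : measurable_fun setT Y.
  by apply: measurable_funM => //; exact: measurable_deviation.
pose Y' : {RV P >-> R} := mfun_Sub (mem_set mY).
have n0 : 0 < n by rewrite ltr0n.
(* This [l] minimises the Chernoff exponent [l ^+ 2 / 2 * n - l * a]; since [a ^+ 2 = 2 * L * n],
   the minimum is [- L]. *)
pose a : R := Num.sqrt (2 * L * n); rewrite -/a; pose l : R := a / n.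
have a0 : 0 < a by rewrite sqrtr_gt0 !mulr_gt0.
have l0 : 0 < l by rewrite divr_gt0.
have := @chernoff _ _ _ P Y' l a l0; rewrite /= => /le_trans; apply.
have -> : ('M_P Y' l = \int[P]_w (expR ((l * s) * dev w))%:E)%E.
  rewrite /mmt_gen_fun unlock; apply: eq_integral => w _ /=.
  by rewrite /Y mulrC mulrA.
have a2 : a ^+ 2 = 2 * L * n by rewrite sqr_sqrtr// !mulr_ge0// ltW.
have la : l * a = 2 * L.
  by rewrite /l mulrAC -expr2 a2 mulfK// gt_eqF.
have -> : expR (- L) = expR (l ^+ 2 / 2 * n) * expR (- (l * a)).
  rewrite -expRD la; congr expR.
  have -> : l ^+ 2 / 2 * n = l * a / 2 by rewrite /l; field; rewrite gt_eqF.
  by rewrite la; lra.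
rewrite EFinM lee_pmul2r// ?lte_fin ?expR_gt0//.
have -> : l ^+ 2 = (l * s) ^+ 2 by rewrite [RHS]exprMn s2 mulr1.
exact: deviation_mgf_le.
Qed.

Lemma hoeffding :
  (P [set w | Num.sqrt (2 * L / n) < `|(\sum_(j in S) X j w) / n - mu|]%R
   <= (2 * expR (- L))%:E)%E.
Proof.
have n0 : 0 < n by rewrite ltr0n.
have mD s : measurable [set w | Num.sqrt (2 * L * n) <= s * dev w].
  have mY : measurable_fun setT (fun w => s * dev w).
    by apply: measurable_funM => //; exact: measurable_deviation.
  rewrite (_ : [set w | _] =
      (fun w => s * dev w) @^-1` `[Num.sqrt (2 * L * n), +oo[).
    by rewrite -[X in measurable X]setTI; exact: mY.
  by apply/seteqP; split => w /=; rewrite in_itv /= andbT.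
have devE w : (\sum_(j in S) X j w) / n - mu = dev w / n.
  rewrite /dev sumrB sumr_const mulrBl; congr (_ - _).
  by rewrite -mulr_natr -/n mulfK// gt_eqF.
apply: (@le_trans _ _ (P ([set w | Num.sqrt (2 * L * n) <= 1 * dev w]%R `|`
                          [set w | Num.sqrt (2 * L * n) <= -1 * dev w]%R))%E).
  apply: le_measure.
  - apply/mem_set.
    have mY : measurable_fun setT (fun w => `|(\sum_(j in S) X j w) / n - mu|).
      under eq_fun do rewrite devE.
      apply: measurableT_comp => //.
      by apply: measurable_funM => //; exact: measurable_deviation.
    rewrite (_ : [set w | _] = (fun w => `|(\sum_(j in S) X j w) / n - mu|)
        @^-1` `]Num.sqrt (2 * L / n), +oo[).
      by rewrite -[X in measurable X]setTI; exact: mY.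
    by apply/seteqP; split => w /=; rewrite in_itv /= andbT.
  - by apply/mem_set; exact: measurableU.
  move=> w /=; rewrite devE normrM (gtr0_norm (x := n^-1)) ?invr_gt0//.
  rewrite ltr_pdivlMr//.
  have -> : Num.sqrt (2 * L / n) * n = Num.sqrt (2 * L * n).
    rewrite -[X in _ * X]ger0_norm ?ltW// -sqrtr_sqr.
    rewrite -sqrtrM ?mulr_ge0 ?invr_ge0 ?ltW//.
    by congr Num.sqrt; field; rewrite gt_eqF.
  by rewrite mul1r mulN1r ltr_normr => /orP[/ltW|/ltW]; [left|right].
apply: (le_trans (measureU2 _ _ _)) => //.
rewrite [X in (_ <= X%:E)%E]mulr_natl mulr2n EFinD leeD// deviation_tail_le//.
- by rewrite expr1n.
- by rewrite sqrrN expr1n.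
Qed.

End hoeffding.

Lemma measurable_rcons d d' (S : measurableType d) (R : measurableType d') t
    (Y : S -> t.-tuple R) (r : S -> R) :
  measurable_fun setT Y -> measurable_fun setT r ->
  measurable_fun setT (fun z => [tuple of rcons (Y z) (r z)]).
Proof.
move=> mY mr; apply/measurable_fun_tnthP => k.
have [kt|tk] := ltnP k t.
  rewrite (_ : _ \o _ = fun z => tnth (Y z) (Ordinal kt)).
    exact: (measurableT_comp (@measurable_tnth _ _ t (Ordinal kt)) mY).
  by apply/funext => z /=; rewrite !(tnth_nth (r z)) /= nth_rcons size_tuple kt.
rewrite (_ : _ \o _ = r)//; apply/funext => z /=.
have kE : k = t :> nat by apply/eqP; rewrite eqn_leq tk -ltnS ltn_ord.
by rewrite (tnth_nth (r z)) /= nth_rcons size_tuple kE ltnn eqxx.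
Qed.

Lemma measure_bigsetU_le d (S : measurableType d) (R : realType)
    (mu : {measure set S -> \bar R}) (I : Type) (s : seq I) (A : I -> set S) :
  (forall i, measurable (A i)) ->
  (mu (\big[setU/set0]_(i <- s) A i) <= \sum_(i <- s) mu (A i))%E.
Proof.
move=> mA; elim: s => [|i s IH]; first by rewrite !big_nil measure0.
rewrite !big_cons; apply: le_trans (measureU2 _ _ _) (leeD2l _ IH) => //.
exact: bigsetU_measurable.
Qed.

(** * Measurability of a run *)

Section run_measurability.
Variables (R : realType) (K T : nat) (M : bandit R K T) (pi : policy R K).
Implicit Types (z : outcome M * seed pi) (t : nat).

Let table z : 'I_K -> nat -> R := fun i n => reward M i n z.1.
Let hist z t := history z.2 (table z) t.

(* On the event that the first arms are [a], the observed rewards are a fixed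
   measurable selection of table entries. *)
Lemma measurable_arms t (a : t.-tuple 'I_K) :
  measurable [set z | unzip1 (hist z t) = a] /\
  exists2 Y : outcome M * seed pi -> t.-tuple R, measurable_fun setT Y &
    forall z, unzip1 (hist z t) = a -> unzip2 (hist z t) = Y z.
Proof.
elim: t a => [|t IH] a.
  split.
    rewrite (_ : [set _ | _] = setT); first exact: measurableT.
    by apply/seteqP; split => z // _ /=; rewrite tuple0.
  by exists (fun=> [tuple]) => //; exact: measurable_cst.
case: a => s; case: (lastP s) => [|a' i] sz /=; first by [].
have {}sz : size a' == t by move: sz; rewrite size_rcons eqSS.
have [mS [Y mY YE]] := IH (Tuple sz).
have histS z : hist z t.+1 =
    rcons (hist z t) (act z.2 (hist z t), reward M (act z.2 (hist z t))
      (npulls (hist z t) (act z.2 (hist z t))) z.1) by [].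
have mA : measurable [set z | act z.2 (zip a' (Y z)) = i].
  have mp : measurable_fun setT (fun z => (z.2, Y z)).
    exact: measurable_fun_pair.
  by have := mp measurableT _ (act_measurable (Tuple sz) i); rewrite setTI.
have zipE z : unzip1 (hist z t) = a' -> hist z t = zip a' (Y z).
  by move=> h1; rewrite -(YE _ h1) -h1 zip_unzip.
split.
  rewrite (_ : [set z | _] = [set z | unzip1 (hist z t) = a'] `&`
      [set z | act z.2 (zip a' (Y z)) = i]); first exact: measurableI.
  apply/seteqP; split => z /=; rewrite histS /unzip1 map_rcons.
    by move=> /rcons_inj[h1 h2]; split => //; rewrite -zipE.
  by move=> [h1 h2]; rewrite [map _ _]h1 -h2 -zipE.
exists (fun z => [tuple of rcons (Y z) (reward M i (count_mem i a') z.1)]).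
  apply: measurable_rcons => //.
  by apply: (measurableT_comp (f := reward M i (count_mem i a'))).
move=> z; rewrite histS /unzip1 /unzip2 !map_rcons /= => /rcons_inj[h1 h2].
rewrite [map _ _](YE _ h1) h2; congr (rcons _ (reward M i _ _)).
by rewrite /npulls -h1 count_map.
Qed.

Lemma measurable_arm t (i : 'I_K) :
  measurable [set z | arm (pi := pi) z.2 (table z) t = i].
Proof.
rewrite (_ : [set z | _] = \bigcup_(a in [set: t.-tuple 'I_K])
    [set z | unzip1 (hist z t.+1) = rcons a i]).
  apply: fin_bigcup_measurable; first exact: finite_finset.
  by move=> a _; exact: (measurable_arms [tuple of rcons a i]).1.
have size_hist z n : size (unzip1 (hist z n)) == n.
  by elim: n => // n IH; rewrite /unzip1 /= map_rcons size_rcons eqSS.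
apply/seteqP; split => z /=.
  move=> <-; exists (Tuple (size_hist z t)) => //=.
  by rewrite /unzip1 map_rcons.
by move=> [a _]; rewrite /unzip1 /= map_rcons => /rcons_inj[].
Qed.

Lemma measurable_run_value : measurable_fun setT (@run_value R K T M pi).
Proof.
rewrite (_ : @run_value _ _ _ _ _ = fun z => \sum_(t < T) \sum_(i < K)
    mean M i * \1_[set z | arm (pi := pi) z.2 (table z) t = i] z).
  apply: measurable_sum => t; apply: measurable_sum => i.
  by apply: measurable_funM => //; apply: measurable_indic; exact: measurable_arm.
apply/funext => z; apply: eq_bigr => t _.
rewrite (bigD1 (arm (pi := pi) z.2 (table z) t))//= indicE mem_set// mulr1.
rewrite big1 ?addr0// => i /negP it; rewrite indicE memNset ?mulr0//=.
by move=> /eqP; rewrite eq_sym.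
Qed.

End run_measurability.

(** * The confidence event *)

Section confidence.
Variables (R : realType) (K T : nat) (M : bandit R K T) (L : R).

(** Quantifying over deterministic counts [n] of table entries, rather than over rounds, avoids the
    dependence between pull counts and rewards. *)
Definition confident (w : outcome M) : Prop :=
  forall i n, (0 < n <= T)%N ->
  `|(\sum_(k < n) reward M i k w) / n%:R - mean M i| <= Num.sqrt (2 * L / n%:R).

Let bad (p : 'I_K * 'I_T) : set (outcome M) :=
  [set w | Num.sqrt (2 * L / p.2.+1%:R) <
           `|(\sum_(k < p.2.+1) reward M p.1 k w) / p.2.+1%:R - mean M p.1|].

Let measurable_bad p : measurable (bad p).
Proof.
have mf : measurable_fun setT (fun w => `|(\sum_(k < p.2.+1) reward M p.1 k w)
    / p.2.+1%:R - mean M p.1|).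
  apply: measurableT_comp => //; apply: measurable_funB => //.
  by apply: measurable_funM => //; exact: measurable_sum.
have := mf measurableT _ (measurable_itv `]Num.sqrt (2 * L / p.2.+1%:R), +oo[).
rewrite setTI; congr measurable.
by apply/seteqP; split => w /=; rewrite in_itv/= andbT.
Qed.

Let confidentE : [set w | confident w] = ~` (\big[setU/set0]_p bad p).
Proof.
rewrite -bigcup_seq; apply/seteqP; split => w /=.
  move=> cw [p _]; rewrite /bad /= ltNge => /negP[].
  by apply: cw; rewrite /= ltn_ord.
move=> nbad i n /andP[]; case: n => // n _ nT; rewrite leNgt; apply/negP => h.
by apply: nbad; exists (i, Ordinal nT); rewrite /= ?mem_index_enum.
Qed.

Lemma measurable_confident : measurable [set w | confident w].
Proof. by rewrite confidentE; apply: measurableC; exact: bigsetU_measurable. Qed.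

(** Lets [hoeffding], applied to the whole independent table, speak of the first [n] entries of one
    arm. *)
Lemma sum_table (V : nmodType) (F : 'I_K -> nat -> V) (i : 'I_K) n :
  (n <= T)%N ->
  \sum_(p in [set p : 'I_K * 'I_T | (p.1 == i) && (p.2 < n)%N]%SET) F p.1 p.2 =
  \sum_(k < n) F i k.
Proof.
move=> nT; under eq_bigl do rewrite inE.
rewrite -(pair_big_dep (fun j => j == i) (fun _ (k : 'I_T) => (k < n)%N)
  (fun j (k : 'I_T) => F j k)) /=.
by rewrite big_pred1_eq [RHS](big_ord_widen _ _ nT).
Qed.

Let bad_le p : 0 < L -> (law M (bad p) <= (2 * expR (- L))%:E)%E.
Proof.
move=> L0; case: p => i n; rewrite /bad /=.
have nT : (n.+1 <= T)%N by exact: ltn_ord.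
have cS : #|[set p : 'I_K * 'I_T | (p.1 == i) && (p.2 < n.+1)%N]%SET| = n.+1.
  rewrite -sum1_card (sum_table (fun _ _ => 1%N))//.
  by rewrite sum1_card card_ord.
have := @hoeffding _ _ _ (law M) _ (fun p : 'I_K * 'I_T => reward M p.1 p.2)
  (mean M i) L [set p : 'I_K * 'I_T | (p.1 == i) && (p.2 < n.+1)%N]%SET.
rewrite cS; move=> /(_ (reward_indep M) _ _ L0 isT) h.
apply: le_trans (h _ _); last first.
- by move=> p; rewrite inE => /andP[/eqP -> _]; exact: reward_mean.
- by move=> p w; exact: reward_unit.
rewrite le_eqVlt; apply/orP; left; apply/eqP; congr (law M _).
apply/seteqP; split => w /=;
  by rewrite (sum_table (fun i k => reward M i k w)).
Qed.

(** Union bound over the pairs (arm, count). Positivity of [L] is conditional because the confidence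
    level is [ln 0 = 0] on an empty horizon, where there is no pair to bound. *)
Lemma law_confident_ge : ((0 < T)%N -> 0 < L) ->
  ((1 - 2 * K%:R * T%:R * expR (- L))%:E <= law M [set w | confident w])%E.
Proof.
move=> L0; rewrite confidentE probability_setC; last exact: bigsetU_measurable.
rewrite EFinB leeB// [X in (_ <= X)%E](_ : _ =
  (\sum_(p : 'I_K * 'I_T) (2 * expR (- L))%:E)%E); last first.
  rewrite sumEFin sumr_const card_prod !card_ord -[X in _ = X%:E]mulr_natr natrM.
  by congr EFin; ring.
apply: le_trans (measure_bigsetU_le _ _ measurable_bad) _.
apply: lee_sum => p _; apply/bad_le/L0.
exact: leq_ltn_trans (ltn_ord p.2).
Qed.

End confidence.

(** Confidence concerns the rewards only, so its cylinder over all seeds has the same probability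
    under the product law; a pathwise bound on that cylinder becomes a bound in probability. *)
Lemma run_law_ge (R : realType) (K T : nat) (M : bandit R K T)
    (pi : policy R K) (L eta a b : R) :
  ((0 < T)%N -> 0 < L) -> 2 * K%:R * T%:R * expR (- L) <= eta ->
  (forall z : outcome M * seed pi,
    confident L z.1 -> a - run_value z <= b) ->
  ((1 - eta)%:E <= run_law M pi [set z | (a - run_value z <= b)%R])%E.
Proof.
move=> L0 Leta good; apply: (@le_trans _ _ (law M [set w | confident L w])).
  by apply: le_trans (law_confident_ge M L0); rewrite lee_fin lerB.
have mc := @measurable_confident R K T M L.
apply: (@le_trans _ _ (run_law M pi ([set w | confident L w] `*` setT))).
  rewrite /run_law /= product_measure1E// [X in (_ <= _ * X)%E]probability_setT.
  by rewrite mule1.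
apply: le_measure.
- by apply/mem_set; apply: measurableX.
- apply/mem_set; have mf : measurable_fun setT (fun z => a - @run_value R K T M pi z).
    by apply: measurable_funB => //; exact: measurable_run_value.
  rewrite (_ : [set z | _] =
      (fun z => a - @run_value R K T M pi z) @^-1` `]-oo, b]%classic).
    by rewrite -[X in measurable X]setTI; exact: mf.
  by apply/seteqP; split => z /=; rewrite in_itv.
- by move=> z [zc _] /=; exact: good.
Qed.

(** * Sums of square roots *)

Section square_root_sums.
Variable R : rcfType.
Implicit Types a b c d : R.

Lemma ler_sqrt_sqr a b : a ^+ 2 <= b -> a <= Num.sqrt b.
Proof.
by move=> /ler_wsqrtr; rewrite sqrtr_sqr; apply: le_trans; exact: ler_norm.
Qed.

(** Cauchy-Schwarz in dimension two, from Lagrange's identity. *)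
Lemma sqrtrM_add_le a b c d : 0 <= a -> 0 <= b -> 0 <= c -> 0 <= d ->
  Num.sqrt (a * b) + Num.sqrt (c * d) <= Num.sqrt ((a + c) * (b + d)).
Proof.
move=> a0 b0 c0 d0; apply: ler_sqrt_sqr; rewrite !sqrtrM//.
rewrite -{2}(sqr_sqrtr a0) -{2}(sqr_sqrtr b0) -{2}(sqr_sqrtr c0).
rewrite -{2}(sqr_sqrtr d0) -subr_ge0.
set p := Num.sqrt a; set q := Num.sqrt b.
set r := Num.sqrt c; set s := Num.sqrt d.
have -> : (p ^+ 2 + r ^+ 2) * (q ^+ 2 + s ^+ 2) - (p * q + r * s) ^+ 2 =
  (p * s - r * q) ^+ 2 by ring.
exact: sqr_ge0.
Qed.

Lemma sum_sqrtrM_le (I : Type) (s : seq I) (P : pred I) (a b : I -> R) :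
  (forall i, 0 <= a i) -> (forall i, 0 <= b i) ->
  \sum_(i <- s | P i) Num.sqrt (a i * b i) <=
  Num.sqrt ((\sum_(i <- s | P i) a i) * \sum_(i <- s | P i) b i).
Proof.
move=> a0 b0; elim: s => [|i s IH]; first by rewrite !big_nil mul0r sqrtr0.
rewrite !big_cons; case: ifP => // _.
apply: le_trans (sqrtrM_add_le _ _ _ _); rewrite ?sumr_ge0//.
by rewrite lerD2l.
Qed.

(** With [p] and [q] the two roots, [p ^+ 2 - q ^+ 2 = 1], hence
    [2 * p * (p - q) = 1 + (p - q) ^+ 2]. *)
Lemma inv_sqrt_le_sub n :
  (Num.sqrt n.+1%:R)^-1 <= 2 * (Num.sqrt n.+1%:R - Num.sqrt n%:R) :> R.
Proof.
set p := Num.sqrt n.+1%:R; set q := Num.sqrt n%:R.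
have p0 : 0 < p by rewrite sqrtr_gt0 ltr0n.
have q0 : 0 <= q by exact: sqrtr_ge0.
have pq : p ^+ 2 = q ^+ 2 + 1 by rewrite !sqr_sqrtr ?ler0n// natr1.
rewrite -[_^-1]mul1r ler_pdivrMr//.
by have := sqr_ge0 (p - q); nra.
Qed.

(* The [k]-th selected round loses at most [2 sqrt (c / (k - 1))], which
   telescopes against [4 sqrt (c n)]; for [k = 1] this is void and the bound [1]
   is used instead. *)
Lemma sum_loss_le (c : R) (l : nat -> R) (N : nat -> nat) (p : pred nat) T :
  0 <= c -> (forall t, (t < T)%N -> l t <= 1) ->
  (forall t, (t < T)%N -> (0 < N t)%N -> p t ->
    l t <= 2 * Num.sqrt (c / (N t)%:R)) ->
  (forall t, (\sum_(k < t) p k <= N t)%N) ->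
  \sum_(t < T | p t) l t <=
    1 + 4 * Num.sqrt c * Num.sqrt (\sum_(t < T) p t)%N%:R.
Proof.
move=> c0 l1 lN pN; have sc0 : 0 <= Num.sqrt c by exact: sqrtr_ge0.
(* The induction carries [n - 1] under the root: [phi 1 = 1] pays for the first selected round, and
   each later increment dominates one loss by [inv_sqrt_le_sub]. *)
pose phi (n : nat) : R :=
  if n is n'.+1 then 1 + 4 * Num.sqrt c * Num.sqrt n'%:R else 0.
suff main : \sum_(t < T | p t) l t <= phi (\sum_(t < T) p t)%N.
  apply: (le_trans main); case: (\sum_(t < T) p t)%N => [|n] /=.
    by rewrite sqrtr0 mulr0 addr0.
  by rewrite lerD2l ler_wpM2l ?mulr_ge0// ler_wsqrtr// ler_nat.
elim: T l1 lN => [|T IH] l1 lN; first by rewrite !big_ord0.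
rewrite big_mkcond /= !big_ord_recr /= -big_mkcond /=.
have {}IH := IH (fun t tT => l1 t (ltnW tT)) (fun t tT => lN t (ltnW tT)).
have [pT|npT] := boolP (p T); last by rewrite addr0 addn0.
rewrite addn1; apply: (@le_trans _ _ (phi (\sum_(t < T) p t)%N + l T)).
  by rewrite lerD2r.
have := pN T; case: (\sum_(t < T) p t)%N => [|n] /= nN.
  by rewrite add0r sqrtr0 mulr0 addr0 l1.
have N0 : (0 < N T)%N by exact: leq_trans nN.
rewrite -addrA lerD2l -lerBrDl -mulrBr.
apply: le_trans (lN T _ N0 pT) _ => //.
apply: (@le_trans _ _ (2 * (Num.sqrt c * (Num.sqrt n.+1%:R)^-1))).
  rewrite ler_pM2l// -sqrtrV ?ler0n// -sqrtrM//.
  by rewrite ler_wsqrtr// ler_wpM2l// lef_pV2 ?posrE ?ltr0n// ler_nat.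
have -> : 4 * Num.sqrt c * (Num.sqrt n.+1%:R - Num.sqrt n%:R) =
  2 * (Num.sqrt c * (2 * (Num.sqrt n.+1%:R - Num.sqrt n%:R))) by ring.
by rewrite ler_pM2l// ler_wpM2l// inv_sqrt_le_sub.
Qed.

End square_root_sums.

(** * Pull counts, observed rewards and optimism along a run *)

Section run_statistics.
Variables (R : realType) (K : nat) (pi : policy R K).
Variables (u : seed pi) (x : 'I_K -> nat -> R).

Lemma npulls_history t i :
  npulls (history u x t) i = (\sum_(k < t) (arm u x k == i))%N.
Proof.
elim: t => [|t IH]; first by rewrite big_ord0.
by rewrite /npulls /= -cats1 count_cat /= addn0 big_ord_recr -IH.
Qed.

(** Each pull of an arm reads the next entry of its row, so the rewards observed are an initial
    segment of the row, to which [confident] applies. *)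
Lemma sum_rewards_history t i :
  \sum_(p <- history u x t | p.1 == i) p.2 =
  \sum_(k < npulls (history u x t) i) x i k.
Proof.
elim: t => [|t IH]; first by rewrite big_nil big_ord0.
rewrite /= -cats1 big_cat big_cons big_nil /= IH /npulls count_cat /= addn0.
case: eqP => [->|_]; last by rewrite addr0 addn0.
by rewrite addn1 big_ord_recr addr0.
Qed.

(** Optimism: [mu j] is at most the index of [j], which is at most the index of the pulled arm,
    which exceeds the mean of that arm by at most two confidence radii. *)
Lemma ucb_gap (mu : 'I_K -> R) (L : R) (T t : nat) (S : {set 'I_K}) j :
  (forall i n, (0 < n <= T)%N ->
    `|(\sum_(k < n) x i k) / n%:R - mu i| <= Num.sqrt (2 * L / n%:R)) ->
  (t < T)%N -> is_argmax S (ucb L (history u x t)) (arm u x t) -> j \in S ->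
  (0 < npulls (history u x t) (arm u x t))%N ->
  mu j - mu (arm u x t) <=
    2 * Num.sqrt (2 * L / (npulls (history u x t) (arm u x t))%:R).
Proof.
move=> conf tT [iS /(_ j) imax] jS Ni.
have {}imax := imax jS.
have N_le k : (npulls (history u x t) k <= T)%N.
  apply: leq_trans (ltnW tT); rewrite npulls_history.
  apply: (@leq_trans (\sum_(k0 < t) 1)); last by rewrite sum1_card card_ord.
  by apply: leq_sum => k0 _; exact: leq_b1.
set i := arm u x t in imax Ni *.
(* An unobserved [j] has index [+oo], which cannot lie below the finite index of [i]. *)
move: imax; rewrite /ucb (gtn_eqF Ni); case: eqVneq => [_|]; first by rewrite leye_eq.
rewrite -lt0n lee_fin /empirical_mean !sum_rewards_history => Nj.
have := conf i _ (introT andP (conj Ni (N_le i))).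
have := conf j _ (introT andP (conj Nj (N_le j))).
rewrite !ler_norml => /andP[h1 h2] /andP[h3 h4] h5.
lra.
Qed.

End run_statistics.

(** * Blocks, schedules and the fractional optimum *)

Section block_structure.
Variables (K B : nat) (H : 'I_B -> nat).
Variables (G : {set {set 'I_K}}) (f : 'I_B -> {set 'I_K} -> nat).
Let T := horizon H.

(** Extends [block_start] to every natural number, so that [cum B] is the horizon. *)
Let cum n := (\sum_(c < B | (c < n)%N) H c)%N.

Let cumS (b : 'I_B) : cum b.+1 = (cum b + H b)%N.
Proof.
rewrite /cum (bigD1 b)//= addnC; congr (_ + _)%N; apply: eq_bigl => c.
by rewrite ltnS [RHS]ltn_neqAle andbC.
Qed.

Let cum_le m n : (m <= n)%N -> (cum m <= cum n)%N.
Proof.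
move=> mn; rewrite /cum [leqRHS]big_mkcond [leqLHS]big_mkcond /=.
by apply: leq_sum => c _; case: ltnP => // cm; rewrite (leq_trans cm).
Qed.

Lemma in_block_unique t : (t < T)%N -> (\sum_(b < B) in_block H b t = 1)%N.
Proof.
move=> tT.
have cumB : (t < cum B)%N.
  by rewrite /cum (eq_bigl xpredT)// => c; rewrite ltn_ord.
have ex : exists n, (t < cum n)%N by exists B.
(* The block of [t] is the predecessor of the least [n] with [t < cum n]. *)
case: (ex_minnP ex) => -[|n] tn nmin; first by move: tn; rewrite /cum big_pred0.
have nB : (n < B)%N by exact: nmin.
pose b := Ordinal nB.
have tb : in_block H b t.
  rewrite /in_block -/(cum b) -cumS tn andbT leqNgt; apply/negP => /nmin.
  by rewrite ltnn.
rewrite (bigD1 b)//= tb big1 ?addn0// => c cb; apply/eqP; rewrite eqb0.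
apply/negP => /andP[]; rewrite -/(cum c) -cumS => ct tc.
move: tb => /andP[]; rewrite -/(cum b) -cumS => bt tb.
move: cb; rewrite -val_eqE neq_ltn => /orP[cb|bc].
  by move: (leq_trans tc (leq_trans (cum_le cb) bt)); rewrite ltnn.
by move: (leq_trans tb (leq_trans (cum_le bc) ct)); rewrite ltnn.
Qed.

Lemma block_countE b (p : pred nat) :
  block_count H b p = (\sum_(t < T) (in_block H b t && p t))%N.
Proof. by rewrite /block_count -sum1_card big_mkcond. Qed.

Lemma sum_block_count (p : pred nat) :
  (\sum_(b < B) block_count H b p = \sum_(t < T) p t)%N.
Proof.
under eq_bigr do rewrite block_countE.
rewrite exchange_big /=; apply: eq_bigr => t _.
case: (p t); last by rewrite big1// => b _; rewrite andbF.
by under eq_bigr do rewrite andbT; exact: in_block_unique.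
Qed.

Variable s : nat -> option {set 'I_K}.
Hypothesis s_valid : valid_schedule H G f s.
Hypothesis floors_fit : forall b, (\sum_(g in G) f b g <= H b)%N.

Lemma sum_contexts (V : nmodType) (F : nat -> V) :
  \sum_(t < T) F t = \sum_(t < T | s t == None) F t +
    \sum_(g in G) \sum_(t < T | s t == Some g) F t.
Proof.
rewrite (bigID (fun t : 'I_T => s t == None)) /=; congr (_ + _).
(* [set0] is only a default: the sum runs over rounds where [s t] is some group. *)
rewrite (partition_big (fun t : 'I_T => odflt finset.set0 (s t)) (mem G)) /=.
  apply: eq_bigr => g _; apply: eq_bigl => t.
  by case: (s t) => [g'|] //=.
move=> t; case st: (s t) => [g|] // _; have [sG _ _] := s_valid.
by apply: sG st; exact: ltn_ord.
Qed.

Lemma count_covering g : g \in G ->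
  (\sum_(t < T) (s t == Some g) = total_floor f g)%N.
Proof.
move=> gG; have [_ sf _] := s_valid.
rewrite -(sum_block_count (fun t => s t == Some g)).
by apply: eq_bigr => b _; rewrite sf.
Qed.

Lemma sum_total_floor :
  (\sum_(g in G) total_floor f g = \sum_(b < B) \sum_(g in G) f b g)%N.
Proof. by rewrite exchange_big. Qed.

Lemma total_floors_fit : (\sum_(g in G) total_floor f g <= T)%N.
Proof. by rewrite sum_total_floor; exact: leq_sum. Qed.

Lemma sum_block_surplus :
  (\sum_(b < B) block_surplus H G f b = total_surplus H G f)%N.
Proof.
apply/eqP; rewrite -(eqn_add2r (\sum_(g in G) total_floor f g)%N).
rewrite subnK ?total_floors_fit// sum_total_floor -big_split /=; apply/eqP.
by apply: eq_bigr => b _; rewrite subnK.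
Qed.

Lemma count_surplus : (\sum_(t < T) (s t == None) = total_surplus H G f)%N.
Proof.
have TE : T = (\sum_(t < T) (s t == None) +
    \sum_(g in G) \sum_(t < T) (s t == Some g))%N.
  rewrite [LHS](_ : T = \sum_(t < T) 1)%N; last by rewrite sum1_card card_ord.
  rewrite (sum_contexts (fun=> 1%N)); congr addn; first by rewrite big_mkcond.
  by apply: eq_bigr => g _; rewrite big_mkcond.
apply/eqP; rewrite -(eqn_add2r (\sum_(g in G) total_floor f g)%N).
rewrite subnK ?total_floors_fit// eq_sym; apply/eqP; rewrite -/T {1}TE.
by congr addn; apply: eq_bigr => g gG; exact: count_covering.
Qed.

End block_structure.

(** * Bounds on the fractional optimum *)

Section fractional_optimum.
Variables (K B : nat) (H : 'I_B -> nat).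
Variables (G : {set {set 'I_K}}) (f : 'I_B -> {set 'I_K} -> nat).
Variables (R : realType) (mu : 'I_K -> R).
Hypothesis mu0 : forall i, 0 <= mu i.
Hypothesis G_trivial : finset.trivIset G.
Hypothesis floors_fit : forall b, (\sum_(g in G) f b g <= H b)%N.

(** A weak duality argument: by disjointness each group is priced separately, its floor at [v g] and
    its excess over the floor at [w >= v g]; the mass outside the groups is priced at [w]. *)
Lemma feasible_value_le (v : {set 'I_K} -> R) (w : R) b y :
  (forall g i, g \in G -> i \in g -> mu i <= v g) ->
  (forall g, g \in G -> v g <= w) -> (forall i, mu i <= w) ->
  feasible H G f b y ->
  \sum_(i < K) mu i * y i <=
    \sum_(g in G) (f b g)%:R * v g + (block_surplus H G f b)%:R * w.
Proof.
move=> muv vw muw [y0 yf ysum].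
have split_sum (F : 'I_K -> R) : \sum_(i < K) F i =
    \sum_(g in G) \sum_(i in g) F i + \sum_(i < K | i \notin finset.cover G) F i.
  by rewrite (bigID (mem (finset.cover G)))/= finset.big_trivIset.
rewrite /block_surplus natrB// natr_sum -ysum !split_sum.
have hout : \sum_(i < K | i \notin finset.cover G) mu i * y i <=
    w * \sum_(i < K | i \notin finset.cover G) y i.
  by rewrite mulr_sumr; apply: ler_sum => i _; rewrite ler_wpM2r.
have hin : \sum_(g in G) \sum_(i in g) mu i * y i <=
    \sum_(g in G) ((f b g)%:R * v g + w * (\sum_(i in g) y i - (f b g)%:R)).
  apply: ler_sum => g gG.
  apply: (@le_trans _ _ (v g * \sum_(i in g) y i)).
    by rewrite mulr_sumr; apply: ler_sum => i ig; rewrite ler_wpM2r// muv.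
  have := ler_wpM2r (_ : 0 <= \sum_(i in g) y i - (f b g)%:R) (vw _ gG).
  by rewrite subr_ge0 yf// => /(_ isT); lra.
move: hin; rewrite big_split /= -mulr_sumr sumrB => hin.
by lra.
Qed.

Lemma block_opt_le (v : {set 'I_K} -> R) (w : R) b :
  (forall g i, g \in G -> i \in g -> mu i <= v g) ->
  (forall g, g \in G -> 0 <= v g <= w) -> (forall i, mu i <= w) -> 0 <= w ->
  block_opt H G f mu b <=
    \sum_(g in G) (f b g)%:R * v g + (block_surplus H G f b)%:R * w.
Proof.
move=> muv v0w muw w0; rewrite /block_opt.
have vw g : g \in G -> v g <= w by move=> /v0w/andP[].
(* The supremum of the empty set is 0, covered by the signs of [v] and [w]. *)
have [->|/set0P ne] := eqVneq [set \sum_(i < K) mu i * y i | y in feasible H G f b] set0.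
  rewrite sup0 addr_ge0// ?mulr_ge0// sumr_ge0// => g /v0w/andP[v0 _].
  by rewrite mulr_ge0.
by apply: ge_sup => // _ [y yf <-]; exact: feasible_value_le.
Qed.

Lemma block_opt_ge b y : feasible H G f b y ->
  \sum_(i < K) mu i * y i <= block_opt H G f mu b.
Proof.
move=> yf; apply: ub_le_sup; last by exists y.
(* The supremum dominates its elements only if the set is bounded: each coordinate of a feasible
   point is at most [H b]. *)
exists (\sum_(i < K) mu i * (H b)%:R) => _ [y' [y'0 _ ysum] <-].
apply: ler_sum => i _; rewrite ler_wpM2l// -ysum (bigD1 i)//= lerDl.
by rewrite sumr_ge0.
Qed.

Lemma opt_frac_le (v : {set 'I_K} -> R) (w : R) :
  (forall g i, g \in G -> i \in g -> mu i <= v g) ->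
  (forall g, g \in G -> 0 <= v g <= w) -> (forall i, mu i <= w) -> 0 <= w ->
  opt_frac H G f mu <= \sum_(g in G) (total_floor f g)%:R * v g
                       + (total_surplus H G f)%:R * w.
Proof.
move=> muv v0w muw w0.
apply: (@le_trans _ _ (\sum_(b < B) (\sum_(g in G) (f b g)%:R * v g
    + (block_surplus H G f b)%:R * w))).
  by apply: ler_sum => b _; exact: block_opt_le.
rewrite big_split /= exchange_big /= -mulr_suml -natr_sum sum_block_surplus//.
rewrite lerD2r ler_sum// => g _.
by rewrite -mulr_suml -natr_sum.
Qed.

End fractional_optimum.

Lemma exists_best (R : realType) (K : nat) (mu : 'I_K -> R) (S : {set 'I_K}) :
  S != finset.set0 -> exists2 j, j \in S & forall i, i \in S -> mu i <= mu j.
Proof.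
by move=> /finset.set0Pn[i0 i0S]; case: (arg_maxP mu i0S) => j jS jmax; exists j.
Qed.

Definition context_arms (K : nat) (c : option {set 'I_K}) : {set 'I_K} :=
  if c is Some g then g else [set: 'I_K]%SET.

(** * Regret of D-BDQ-UCB on the confidence event *)

Section regret.
Variables (R : realType) (K B : nat) (H : 'I_B -> nat).
Variables (G : {set {set 'I_K}}) (f : 'I_B -> {set 'I_K} -> nat).
Variables (L : R) (s : nat -> option {set 'I_K}) (pi : policy R K).
Hypothesis K0 : (0 < K)%N.
Hypothesis G_nonempty : forall g, g \in G -> g != finset.set0.
Hypothesis G_trivial : finset.trivIset G.
Hypothesis floors_fit : forall b, (\sum_(g in G) f b g <= H b)%N.
Hypothesis pi_ucb : dbdq_ucb H G f L s pi.
Let T := horizon H.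
Let s_valid : valid_schedule H G f s := pi_ucb.1.

Section one_run.
Variables (u : seed pi) (x : 'I_K -> nat -> R).
Hypothesis x_unit : unit_table x.
Let A t := arm u x t.

Lemma arm_context t : (t < T)%N -> A t \in context_arms (s t).
Proof. by move=> tT; have [] := pi_ucb.2 u x x_unit t tT. Qed.

(** Disjointness prevents a covering pull for one group from landing in another, which makes the
    covering counts exact. *)
Lemma covering_arm t g g' : (t < T)%N -> s t = Some g' -> g \in G ->
  (A t \in g) = (s t == Some g).
Proof.
move=> tT st gG; have := arm_context tT; rewrite st /= => Ag'.
have [s_in _ _] := s_valid; have g'G := s_in _ _ tT st.
apply/idP/eqP => [Ag|[<-]//]; congr Some; apply/eqP; apply: contraT => ne.
have /disjoint_setI0 := finset.trivIsetP G_trivial _ _ g'G gG ne.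
by move/setP/(_ (A t)); rewrite !inE Ag Ag'.
Qed.

Lemma covering_count b g : g \in G ->
  block_count H b (fun t => (s t != None) && (A t \in g)) = f b g.
Proof.
move=> gG; have [_ /(_ b _ gG) <- _] := s_valid.
apply: eq_card => t; rewrite !inE; congr (_ && _).
case st: (s t) => [g'|] //=.
by rewrite (covering_arm _ st gG)// st.
Qed.

Lemma floor_met b g : g \in G ->
  (f b g <= \sum_(i in g) block_count H b (fun t => A t == i))%N.
Proof.
move=> gG; rewrite -(covering_count b gG).
under eq_bigr do rewrite block_countE.
rewrite exchange_big block_countE /=; apply: leq_sum => t _.
case: (in_block H b t) => //=; case: (s t != None) => //=.
have [Ag|//] := boolP (A t \in g).
by rewrite (bigD1 (A t))//= eqxx.
Qed.

Variable mu : 'I_K -> R.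
Hypothesis mu01 : forall i, 0 <= mu i <= 1.
Hypothesis L_ge0 : 0 <= L.
Hypothesis x_confident : forall i n, (0 < n <= T)%N ->
  `|(\sum_(k < n) x i k) / n%:R - mu i| <= Num.sqrt (2 * L / n%:R).

Let c0 : 0 <= 2 * L. Proof. by rewrite mulr_ge0. Qed.

(** The rounds of the context are split by pulled arm; [sum_loss_le] bounds each part, and
    Cauchy-Schwarz over the arms recombines the square roots. *)
Lemma context_regret (c : option {set 'I_K}) j : j \in context_arms c ->
  \sum_(t < T | s t == c) (mu j - mu (A t)) <= #|context_arms c|%:R +
    4 * Num.sqrt (2 * L) *
      Num.sqrt (#|context_arms c|%:R * (\sum_(t < T) (s t == c))%:R).
Proof.
set S := context_arms c => jS.
have AS (t : 'I_T) : s t == c -> A t \in S.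
  by move=> /eqP stc; rewrite /S -stc arm_context.
pose cnt i := (\sum_(t < T) ((s t == c) && (A t == i)))%N.
rewrite (partition_big (fun t : 'I_T => A t) (mem S)) /=; last exact: AS.
apply: (@le_trans _ _ (\sum_(i in S)
    (1 + 4 * Num.sqrt (2 * L) * Num.sqrt (cnt i)%:R))).
  apply: ler_sum => i iS.
  apply: (@sum_loss_le _ (2 * L) (fun t => mu j - mu (A t))
    (fun t => npulls (history u x t) i) (fun t => (s t == c) && (A t == i))) => //.
  - by move=> t tT; have := mu01 j; have := mu01 (A t); lra.
  - move=> t tT Ni /andP[/eqP stc /eqP Ati]; rewrite -Ati in Ni *.
    apply: (ucb_gap (S := S) x_confident) => //.
    by have := pi_ucb.2 u x x_unit t tT; rewrite stc.
  (* The confidence radius uses the pulls of [i] in all contexts, at least as many as those in the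
     context [c]. *)
  - move=> t; rewrite npulls_history; apply: leq_sum => k _.
    by case: (s k == c).
rewrite big_split /= sumr_const lerD2l -mulr_sumr ler_wpM2l ?mulr_ge0//.
have -> : (\sum_(t < T) (s t == c))%:R = \sum_(i in S) (cnt i)%:R :> R.
  rewrite -natr_sum; congr (_%:R).
  transitivity (\sum_(t < T | s t == c) 1)%N; first by rewrite [RHS]big_mkcond.
  rewrite (partition_big (fun t : 'I_T => A t) (mem S)) /=; last exact: AS.
  by apply: eq_bigr => i _; rewrite big_mkcond.
have <- : \sum_(i in S) 1 = #|S|%:R :> R by rewrite sumr_const.
have := @sum_sqrtrM_le R _ (index_enum 'I_K) (mem S) (fun=> 1) (fun i => (cnt i)%:R).
rewrite /= => /(_ (fun=> ler01) (fun i => ler0n _ _)).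
by under eq_bigr do rewrite mul1r.
Qed.

(** The optimum is bounded by pricing floors at the best arm of each group and surplus at the best
    arm overall; the schedule has exactly as many rounds of each kind, so the difference splits
    round by round. *)
Lemma regret_decomposition (best : {set 'I_K} -> 'I_K) (top : 'I_K) :
  (forall g, g \in G -> best g \in g) ->
  (forall g i, g \in G -> i \in g -> mu i <= mu (best g)) ->
  (forall i, mu i <= mu top) ->
  opt_frac H G f mu - realized_value mu T u x <=
    \sum_(g in G) \sum_(t < T | s t == Some g) (mu (best g) - mu (A t)) +
    \sum_(t < T | s t == None) (mu top - mu (A t)).
Proof.
move=> best_in best_max top_max.
have mu0 i : 0 <= mu i by case/andP: (mu01 i).
have := @opt_frac_le _ _ H G f R mu G_trivial floors_fit
  (fun g => mu (best g)) (mu top) best_max _ top_max (mu0 _).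
rewrite /realized_value (sum_contexts s_valid (fun t => mu (A t))) => h.
have {}h := h (fun g _ => introT andP (conj (mu0 _) (top_max _))).
have cnt c w : \sum_(t < T | s t == c) w = (\sum_(t < T) (s t == c))%:R * w :> R.
  rewrite natr_sum mulr_suml [LHS]big_mkcond; apply: eq_bigr => t _.
  by case: (s t == c); rewrite ?mul1r ?mul0r.
have -> : \sum_(g in G) \sum_(t < T | s t == Some g) (mu (best g) - mu (A t)) =
    \sum_(g in G) (total_floor f g)%:R * mu (best g) -
    \sum_(g in G) \sum_(t < T | s t == Some g) mu (A t).
  rewrite -sumrB; apply: eq_bigr => g gG.
  by rewrite sumrB cnt (count_covering s_valid gG).
have -> : \sum_(t < T | s t == None) (mu top - mu (A t)) =
    (total_surplus H G f)%:R * mu top - \sum_(t < T | s t == None) mu (A t).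
  by rewrite sumrB cnt (count_surplus s_valid floors_fit).
rewrite -/T; lra.
Qed.

Lemma exists_benchmarks : exists (best : {set 'I_K} -> 'I_K) (top : 'I_K),
  [/\ forall g, g \in G -> best g \in g,
      forall g i, g \in G -> i \in g -> mu i <= mu (best g)
    & forall i, mu i <= mu top].
Proof.
have [|top _ topP] := @exists_best _ _ mu [set: 'I_K]%SET.
  by apply/finset.set0Pn; exists (Ordinal K0); rewrite inE.
have /choice[best bestP] : forall g : {set 'I_K}, exists j, g \in G ->
    j \in g /\ forall i, i \in g -> mu i <= mu j.
  move=> g; have [gG|] := boolP (g \in G); last by exists top.
  by have [j jg jmax] := exists_best mu (G_nonempty gG); exists j.
exists best, top; split=> [g /bestP[]//|g i /bestP[_ h] /h//|i].
by apply: topP; rewrite inE.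
Qed.

Lemma sum_card_groups : (\sum_(g in G) #|g| <= K)%N.
Proof.
have /eqP -> := G_trivial.
by rewrite -[leqRHS](card_ord K); exact: max_card.
Qed.

Lemma group_regret :
  opt_frac H G f mu - realized_value mu T u x <= group_bound H G f L.
Proof.
have [best [top [best_in best_max top_max]]] := exists_benchmarks.
apply: le_trans (regret_decomposition best_in best_max top_max) _.
have hsur := @context_regret None top (finset.in_setT _).
rewrite (count_surplus s_valid floors_fit) cardsT card_ord in hsur.
have hcov : \sum_(g in G) \sum_(t < T | s t == Some g) (mu (best g) - mu (A t)) <=
    \sum_(g in G) (#|g|%:R + 4 * Num.sqrt (2 * L) *
      Num.sqrt (#|g|%:R * (total_floor f g)%:R)).
  apply: ler_sum => g gG; rewrite -(count_covering s_valid gG).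
  by apply: (@context_regret (Some g)); exact: best_in.
(* First observations cost at most [K] over all groups and [K] over the surplus, within the [4 * K]
   of the bound. *)
have cards : \sum_(g in G) #|g|%:R <= K%:R :> R.
  by rewrite -natr_sum ler_nat sum_card_groups.
rewrite big_split /= -mulr_sumr in hcov.
rewrite /group_bound mulrDr.
have Kr : 0 <= K%:R :> R by [].
lra.
Qed.

Lemma singleton_regret : (forall g, g \in G -> #|g| = 1%N) ->
  opt_frac H G f mu - realized_value mu T u x <= singleton_bound H G f L.
Proof.
move=> G1; have [best [top [best_in best_max top_max]]] := exists_benchmarks.
apply: le_trans (regret_decomposition best_in best_max top_max) _.
have hsur := @context_regret None top (finset.in_setT _).
rewrite (count_surplus s_valid floors_fit) cardsT card_ord in hsur.
(* In a singleton group the covering pull is the benchmark arm itself, so only surplus rounds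
   lose. *)
rewrite big1 ?add0r; last first.
  move=> g gG; apply: big1 => t /eqP st.
  have /cards1P[i gi] : #|g| == 1%N by rewrite G1.
  have := best_in g gG; have := arm_context (ltn_ord t).
  by rewrite st /= gi !inE => /eqP -> /eqP ->; rewrite subrr.
apply: le_trans hsur _; rewrite /singleton_bound lerD2l -mulrA ler_pM2l//.
rewrite -sqrtrM// le_eqVlt; apply/orP; left; apply/eqP; congr Num.sqrt.
by ring.
Qed.

End one_run.
End regret.

(** * Closed forms of the bounds *)

Section bounds.
Variables (R : realType) (K B : nat) (H : 'I_B -> nat).
Variables (G : {set {set 'I_K}}) (f : 'I_B -> {set 'I_K} -> nat).
Hypothesis G_trivial : finset.trivIset G.
Hypothesis floors_fit : forall b, (\sum_(g in G) f b g <= H b)%N.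

(** Cauchy-Schwarz across contexts: their sizes sum to at most [2 * K] and their lengths to [T];
    then [4 * sqrt (2 L) * sqrt (2 K T) = 8 * sqrt (K T L)]. *)
Lemma group_bound_le_coarse (L : R) :
  group_bound H G f L <= coarse_bound K H L.
Proof.
rewrite /group_bound /coarse_bound lerD2l.
have [L0|L0] := leP 0 L; last first.
  rewrite (@ler0_sqrtr _ (2 * L)); last by lra.
  by rewrite mulr0 mul0r mulr_ge0.
set T := horizon H; set S := \sum_(g in G) _.
have TE : T%:R = \sum_(g in G) (total_floor f g)%:R + (total_surplus H G f)%:R :> R.
  by rewrite -natr_sum -natrD subnKC// total_floors_fit.
have hS : S + Num.sqrt (K%:R * (total_surplus H G f)%:R) <=
    Num.sqrt (2 * K%:R * T%:R).
  apply: (@le_trans _ _ (Num.sqrt ((\sum_(g in G) #|g|%:R + K%:R) * T%:R))).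
    rewrite TE; apply: le_trans (sqrtrM_add_le _ _ _ _); rewrite ?sumr_ge0//.
    by rewrite lerD2r; exact: sum_sqrtrM_le.
  rewrite ler_wsqrtr// ler_wpM2r// mulr_natl mulr2n lerD2r -natr_sum ler_nat.
  exact: sum_card_groups.
apply: (@le_trans _ _ (4 * Num.sqrt (2 * L) * Num.sqrt (2 * K%:R * T%:R))).
  by rewrite ler_wpM2l// mulr_ge0.
rewrite -mulrA -sqrtrM ?mulr_ge0//.
have -> : 2 * L * (2 * K%:R * T%:R) = 2 ^+ 2 * (K%:R * T%:R * L) by ring.
rewrite sqrtrM ?sqr_ge0// sqrtr_sqr ger0_norm// mulrA.
by rewrite ler_wpM2r//; lra.
Qed.

Hypothesis G_singletons : forall g, g \in G -> #|g| = 1%N.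

Lemma sum_singletons (V : nmodType) (F : {set 'I_K} -> V) :
  \sum_(g in G) F g = \sum_(i < K | [set i]%SET \in G) F [set i]%SET.
Proof.
have -> : G = [set [set i]%SET | i in [set i : 'I_K | [set i]%SET \in G]%SET]%SET.
  apply/setP => g; apply/idP/imsetP => [gG|[i]]; last by rewrite inE => iG ->.
  have /cards1P[i gi] : #|g| == 1%N by rewrite G_singletons.
  by exists i => //; rewrite inE -gi.
rewrite big_imset /=; last by move=> i j _ _; exact: finset.set1_inj.
apply: eq_bigl => i; rewrite inE; apply/idP/imsetP => [iG|[j]].
  by exists i => //; rewrite inE.
by rewrite inE => jG /finset.set1_inj ->.
Qed.

Lemma sum_comparator (mu : 'I_K -> R) istar b :
  \sum_(i < K) mu i * (comparator_pulls H G f istar b i)%:R =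
  \sum_(i < K | [set i]%SET \in G) (f b [set i]%SET)%:R * mu i +
  (block_surplus H G f b)%:R * mu istar.
Proof.
rewrite /comparator_pulls; under eq_bigr do rewrite natrD mulrDr.
rewrite big_split /=; congr (_ + _).
  rewrite [RHS]big_mkcond; apply: eq_bigr => i _.
  by case: ifP; rewrite ?mulr0// mulrC.
rewrite (bigD1 istar)//= eqxx big1 ?addr0 1?mulrC// => i /negPf ->.
by rewrite mulr0.
Qed.

(** The comparator is feasible, and pricing each singleton at the mean of its arm and the surplus at
    [mu istar] gives the matching upper bound. *)
Lemma opt_frac_comparator (mu : 'I_K -> R) istar :
  (forall i, 0 <= mu i) -> (forall i, mu i <= mu istar) ->
  opt_frac H G f mu = comparator_value H G f mu istar.
Proof.
move=> mu0 mustar; apply: eq_bigr => b _; apply/eqP; rewrite eq_le.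
apply/andP; split.
  pose v (g : {set 'I_K}) := \sum_(i in g) mu i.
  have v1 i : v [set i]%SET = mu i by rewrite /v big_set1.
  have vG (g : {set 'I_K}) : g \in G -> exists i, g = [set i]%SET.
    by move=> gG; apply/cards1P; rewrite G_singletons.
  rewrite sum_comparator; under eq_bigr do rewrite -v1.
  rewrite -(sum_singletons (fun g => (f b g)%:R * v g)).
  apply: block_opt_le => //.
  - by move=> g i /vG[j ->]; rewrite v1 inE => /eqP ->.
  - by move=> g /vG[j ->]; rewrite v1 mu0 mustar.
apply: block_opt_ge => //; split=> [i//|g gG|].
  have /cards1P[i gi] : #|g| == 1%N by rewrite G_singletons.
  by rewrite gi big_set1 /comparator_pulls -gi gG ler_nat leq_addr.
(* Unit means turn the value formula into the count of the comparator's pulls. *)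
have := sum_comparator (fun=> 1) istar b.
rewrite /=; under eq_bigr do rewrite mul1r.
under [X in _ = X + _]eq_bigr do rewrite mulr1.
rewrite mulr1 -(sum_singletons (fun g => (f b g)%:R)) => ->.
by rewrite -natr_sum -natrD subnKC.
Qed.

End bounds.

(** * Size of the confidence level *)

Section confidence_level.
Variables (R : realType) (K B : nat) (H : 'I_B -> nat) (eta : R).
Hypotheses (K0 : (0 < K)%N) (eta01 : 0 < eta < 1).
Let T := horizon H.

Lemma conf_argument_gt1 : (0 < T)%N -> 2 <= 2 * K%:R * T%:R / eta.
Proof.
move=> T0; have /andP[e0 e1] := eta01.
rewrite ler_pdivlMr//; apply: (@le_trans _ _ 2); first by lra.
by rewrite -mulrA ler_peMr// -natrM ler1n muln_gt0 K0.
Qed.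

(** From [ln y >= 1 - 1 / y] with [y >= 2]. Besides positivity, this bound lets [sqrt L] absorb the
    additive term of the paired bound. *)
Lemma conf_ge_half : (0 < T)%N -> 1 / 2 <= conf K H eta.
Proof.
move=> T0; have := conf_argument_gt1 T0; rewrite /conf -/T.
set y := _ / eta => y2; have y0 : 0 < y by lra.
have yV : y^-1 <= 1 / 2 by rewrite -[y^-1]mul1r ler_pdivrMr//; lra.
have yV0 : 0 < y^-1 by rewrite invr_gt0.
have := @le_ln1Dx _ (y^-1 - 1); rewrite [1 + _]addrC subrK lnV ?posrE// => h.
by have := h ltac:(lra); lra.
Qed.

Lemma conf_ge0 : 0 <= conf K H eta.
Proof.
have [T0|T0] := posnP T; last by have := conf_ge_half T0; lra.
by rewrite /conf -/T T0 mulr0 mul0r ln0.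
Qed.

Lemma conf_failure : 2 * K%:R * T%:R * expR (- conf K H eta) <= eta.
Proof.
have /andP[e0 e1] := eta01.
have [T0|T0] := posnP T; first by rewrite T0 mulr0 mul0r ltW.
have := conf_argument_gt1 T0; rewrite expRN /conf -/T => y2.
rewrite lnK ?posrE; last by apply: lt_le_trans y2.
have c0 : 2 * K%:R * T%:R != 0 :> R.
  by rewrite !mulf_neq0// pnatr_eq0 -lt0n.
by rewrite invf_div mulrCA divff// mulr1.
Qed.

End confidence_level.

Section paired_bound.
Variables (R : realType) (B h : nat) (grp : 'I_B -> {set 'I_(2 * B + 1)}).
Variables (G : {set {set 'I_(2 * B + 1)}}).
Variables (f : 'I_B -> {set 'I_(2 * B + 1)} -> nat).
Hypothesis layout : paired_layout h grp G f.

Lemma paired_floors_fit b : (\sum_(g in G) f b g <= h)%N.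
Proof.
case: layout => grp_inj -> _ _ fE.
rewrite (bigD1 (grp b)) ?imset_f//= fE eqxx big1 ?addn0; first by lia.
by move=> g /andP[_ /negPf gb]; rewrite fE gb.
Qed.

(** With [q = sqrt h * sqrt L >= 1 / 2] and at most [3 * B] arms, the additive term is at most
    [12 * B <= 24 * B * q] and the root term at most [16 * B * q]. *)
Lemma coarse_bound_paired (L : R) : (0 < B)%N -> (0 < h)%N -> 1 / 2 <= L ->
  coarse_bound (2 * B + 1) (fun _ : 'I_B => h) L <=
  40 * (Num.sqrt L * B%:R * Num.sqrt h%:R).
Proof.
move=> B0 h0 L2; rewrite /coarse_bound /horizon sum_nat_const card_ord.
have K3 : (2 * B + 1)%:R <= 3 * B%:R :> R by rewrite -natrM ler_nat; lia.
have K0 : 0 <= (2 * B + 1)%:R :> R by [].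
have b1 : 1 <= B%:R :> R by rewrite ler1n.
have h1 : 1 <= Num.sqrt h%:R :> R.
  by rewrite -[leLHS](@sqrtr1 R) ler_wsqrtr// ler1n.
have l2 : 1 / 2 <= Num.sqrt L.
  by apply: ler_sqrt_sqr; lra.
have -> : Num.sqrt ((2 * B + 1)%:R * (B * h)%:R * L) =
    Num.sqrt ((2 * B + 1)%:R * B%:R) * (Num.sqrt h%:R * Num.sqrt L).
  by rewrite -!sqrtrM ?mulr_ge0// natrM; congr Num.sqrt; ring.
have hK : Num.sqrt ((2 * B + 1)%:R * B%:R) <= 2 * B%:R :> R.
  rewrite -[leRHS]ger0_norm ?mulr_ge0// -sqrtr_sqr ler_wsqrtr//.
  nra.
have hl : 1 / 2 <= Num.sqrt h%:R * Num.sqrt L by nra.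
set q := Num.sqrt h%:R * Num.sqrt L in hl *.
have -> : Num.sqrt L * B%:R * Num.sqrt h%:R = B%:R * q by rewrite /q; ring.
nra.
Qed.

End paired_bound.

(** * Early pulls of a group *)

Section early_pulls.
Variables (R : realType) (K : nat) (pi : policy R K) (u : seed pi).
Variables (g : {set 'I_K}) (m : nat).
Implicit Types (x : 'I_K -> nat -> R) (t : nat).

Definition group_pulls (h : seq ('I_K * R)) : nat := count (fun p => p.1 \in g) h.

Definition is_early x t : bool :=
  (arm u x t \in g) && (group_pulls (history u x t) < m)%N.

Definition early_pulls x (i : 'I_K) (T : nat) : nat :=
  (\sum_(t < T) (is_early x t && (arm u x t == i)))%N.

Lemma group_pullsS x t :
  group_pulls (history u x t.+1) =
  (group_pulls (history u x t) + (arm u x t \in g))%N.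
Proof. by rewrite /group_pulls /= -cats1 count_cat /= addn0. Qed.

Lemma group_pulls_history x t :
  group_pulls (history u x t) = (\sum_(k < t) (arm u x k \in g))%N.
Proof.
by elim: t => [|t IH]; [rewrite big_ord0|rewrite group_pullsS big_ord_recr IH].
Qed.

Lemma sum_is_early x T :
  (\sum_(t < T) is_early x t = minn m (group_pulls (history u x T)))%N.
Proof.
elim: T => [|T IH]; first by rewrite big_ord0 minn0.
rewrite big_ord_recr IH group_pullsS /is_early /=.
by case: (_ \in g) => /=; case: ltnP; lia.
Qed.

(* The first [m] pulls of the group reveal no table entry of index [>= m]. *)
Variables x x' : 'I_K -> nat -> R.
Hypothesis agree : forall i n, (i \in g -> (n < m)%N) -> x i n = x' i n.

Lemma history_agree t : (group_pulls (history u x t) <= m)%N ->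
  history u x t = history u x' t.
Proof.
elim: t => // t IH; rewrite group_pullsS => le_m.
have {}IH := IH (leq_trans (leq_addr _ _) le_m).
rewrite /= -IH; congr (rcons _ (_, _)); apply: agree => ig.
move: le_m; rewrite /arm ig addn1; apply: leq_ltn_trans.
by apply: sub_count => p /= /eqP ->.
Qed.

End early_pulls.

(** As long as either run has made at most [m] pulls of the group, both histories coincide;
    afterwards neither run has an early pull. *)
Lemma early_pulls_agree (R : realType) (K : nat) (pi : policy R K) (u : seed pi)
    (g : {set 'I_K}) (m : nat) (x x' : 'I_K -> nat -> R) i T :
  (forall i n, (i \in g -> (n < m)%N) -> x i n = x' i n) ->
  early_pulls u g m x i T = early_pulls u g m x' i T.
Proof.
move=> agree; apply: eq_bigr => t _; congr nat_of_bool; rewrite /is_early.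
have [le_m|gt_m] := leqP (group_pulls g (history u x t)) m.
  by rewrite /arm -(history_agree agree le_m).
have [le_m'|gt_m'] := leqP (group_pulls g (history u x' t)) m.
  have agree' j n : (j \in g -> (n < m)%N) -> x' j n = x j n by move=> /agree.
  by rewrite /arm -(history_agree agree' le_m').
by rewrite !ltnNge !(ltnW gt_m) (ltnW gt_m') !andbF.
Qed.

(** * Product Bernoulli laws on Boolean tables *)

Definition flip_coordinate (J : finType) (j : J) (w : {ffun J -> bool}) :
    {ffun J -> bool} :=
  [ffun k => if k == j then ~~ w k else w k].

Lemma flip_coordinateK (J : finType) (j : J) : involutive (flip_coordinate j).
Proof.
move=> w; apply/ffunP => k; rewrite !ffunE.
by case: eqVneq => // _; rewrite negbK.
Qed.

Section finite_products.
Variables (R : realType) (J : finType).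
Implicit Types (p q : J -> R) (w : {ffun J -> bool}) (j : J).

Definition bern (a : R) (v : bool) : R := if v then a else 1 - a.

Definition table_weight p w : R := \prod_j bern (p j) (w j).

Lemma bern_ge0 a v : 0 <= a <= 1 -> 0 <= bern a v.
Proof. by case: v => /andP[a0 a1] //=; rewrite subr_ge0. Qed.

Lemma table_weight_ge0 p w : (forall j, 0 <= p j <= 1) -> 0 <= table_weight p w.
Proof. by move=> p01; apply: prodr_ge0 => j _; exact: bern_ge0. Qed.

(** Independence under the product law, obtained from distributivity of products over sums. *)
Lemma sum_table_weight p (F : J -> bool -> R) :
  \sum_w table_weight p w * \prod_j F j (w j) =
  \prod_j (p j * F j true + (1 - p j) * F j false).
Proof.
rewrite (eq_bigr (fun w : {ffun J -> bool} =>
  \prod_j (bern (p j) (w j) * F j (w j)))); last first.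
  by move=> w _; rewrite big_split.
rewrite -(bigA_distr_bigA (fun j v => bern (p j) v * F j v)) /=.
by apply: eq_bigr => j _; rewrite big_bool.
Qed.

Lemma table_weight_sum1 p : \sum_w table_weight p w = 1.
Proof.
transitivity (\sum_w table_weight p w * \prod_(j : J) 1).
  by apply: eq_bigr => w _; rewrite big1_eq mulr1.
by rewrite (sum_table_weight p (fun _ _ => 1)) big1// => j _; ring.
Qed.

(** Pairing [w] with its flip at [j] replaces the factor at [j] by a sum equal to 1, so the
    right-hand side does not involve [p j]. *)
Let sum_coordinate p j (F : {ffun J -> bool} -> R) :
  (forall w, F (flip_coordinate j w) = F w) ->
  2 * \sum_w table_weight p w * F w =
  \sum_(w : {ffun J -> bool}) (\prod_(k | k != j) bern (p k) (w k)) * F w.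
Proof.
move=> Fj; rewrite mulr_natl mulr2n.
rewrite {2}(reindex_inj (inv_inj (flip_coordinateK j))) /= -big_split /=.
apply: eq_bigr => w _; rewrite Fj -mulrDl; congr (_ * _).
rewrite /table_weight (bigD1 j)//= [X in _ + X](bigD1 j)//= ffunE eqxx.
rewrite [in X in _ + _ * X](eq_bigr (fun k => bern (p k) (w k))); last first.
  by move=> k /negPf kj; rewrite ffunE kj.
by rewrite -mulrDl; case: (w j) => /=; ring.
Qed.

(* The coordinates in [S] are changed one at a time. *)
Lemma table_weight_marginal p q (S : {set J}) (F : {ffun J -> bool} -> R) :
  (forall j, j \notin S -> p j = q j) ->
  (forall w w', (forall j, j \notin S -> w j = w' j) -> F w = F w') ->
  \sum_w table_weight p w * F w = \sum_w table_weight q w * F w.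
Proof.
move=> pq FS; have [n] := ubnP #|[set j | p j != q j]%SET|.
elim: n p pq => // n IH p pq; rewrite ltnS => pn.
have [p0|/finset.set0Pn[j]] := eqVneq [set j | p j != q j]%SET finset.set0.
  apply: eq_bigr => w _; congr (_ * _); apply: eq_bigr => j _; congr bern.
  by apply/eqP; have := p0; move/setP/(_ j); rewrite !inE => /negbFE.
rewrite inE => pqj.
have jS : j \in S by apply: contraNT pqj => /pq ->.
pose p' k := if k == j then q j else p k.
have Fj w : F (flip_coordinate j w) = F w.
  by apply: FS => k kS; rewrite ffunE; case: eqVneq kS => // ->; rewrite jS.
transitivity (\sum_w table_weight p' w * F w).
  apply: (@mulfI _ 2); first by rewrite pnatr_eq0.
  rewrite !(sum_coordinate _ Fj); apply: eq_bigr => w _; congr (_ * _).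
  by apply: eq_bigr => k /negPf kj; rewrite /p' kj.
apply: IH => [k kS|].
  by rewrite /p'; case: eqVneq kS => [->|_ /pq//]; rewrite jS.
apply: leq_trans pn; apply: proper_card; apply/properP; split.
  apply/fintype.subsetP => k; rewrite !inE /p'.
  by case: (eqVneq k j) => [->|//]; rewrite eqxx.
by exists j; rewrite !inE /p' ?eqxx.
Qed.

Lemma bernoulli_inequality (a : R) n : 0 <= a <= 1 -> 1 - n%:R * a <= (1 - a) ^+ n.
Proof.
move=> /andP[a0 a1]; elim: n => [|n IH]; first by rewrite expr0 mul0r subr0.
rewrite exprS -natr1; have n0 : 0 <= n%:R :> R by [].
apply: (@le_trans _ _ ((1 - a) * (1 - n%:R * a))); first by nra.
by rewrite ler_wpM2l// subr_ge0.
Qed.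

Lemma sqrt_prod (F : J -> R) : (forall j, 0 <= F j) ->
  Num.sqrt (\prod_j F j) = \prod_j Num.sqrt (F j).
Proof.
move=> F0; elim: (index_enum J) => [|j s IH]; first by rewrite !big_nil sqrtr1.
by rewrite !big_cons sqrtrM// IH.
Qed.

(* The sum of the two errors is at least [m (sqrt (P Q) - (P + Q) / 4)]
   pointwise, and the Hellinger affinity of the two laws is at least [3 / 4]. *)
Lemma two_point_bound p q (S : {set J}) (eps : R) (m : nat)
    (d0 d1 : {ffun J -> bool} -> R) :
  (forall j, 0 <= p j <= 1) -> (forall j, 0 <= q j <= 1) ->
  (forall j, j \notin S -> p j = q j) ->
  (forall j, j \in S -> p j + q j = 1 /\ p j * q j = 1 / 4 - eps ^+ 2) ->
  #|S| = (2 * m)%N -> 16 * m%:R * eps ^+ 2 <= 1 -> (0 < m)%N ->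
  (forall w, 0 <= d0 w) -> (forall w, 0 <= d1 w) ->
  (forall w, d0 w + d1 w = m%:R) ->
  m%:R / 4 <= \sum_w table_weight p w * d1 w + \sum_w table_weight q w * d0 w.
Proof.
move=> p01 q01 pqS S_pq cardS eps_m m0 d00 d10 dm.
have m1 : 1 <= m%:R :> R by rewrite ler1n.
have e0 := sqr_ge0 eps.
pose rho := \sum_w Num.sqrt (table_weight p w * table_weight q w).
have rhoE : rho = \prod_j (if j \in S then Num.sqrt (1 - 4 * eps ^+ 2) else 1).
  rewrite /rho /table_weight.
  rewrite (eq_bigr (fun w : {ffun J -> bool} =>
      \prod_j Num.sqrt (bern (p j) (w j) * bern (q j) (w j)))); last first.
    move=> w _; rewrite -sqrt_prod ?big_split// => j.
    by rewrite mulr_ge0 ?bern_ge0.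
  rewrite -(bigA_distr_bigA (fun j v => Num.sqrt (bern (p j) v * bern (q j) v))) /=.
  apply: eq_bigr => j _; rewrite big_bool /=.
  have [jS|jS] := ifPn; last first.
    have /andP[q0 q1] := q01 j.
    rewrite (pqS _ jS) -!expr2 !sqrtr_sqr !ger0_norm ?subr_ge0//.
    by rewrite addrC subrK.
  have [s1 s2] := S_pq j jS.
  (* Since [p j + q j = 1], both outcomes contribute equally to the affinity of the coordinate. *)
  have -> : (1 - p j) * (1 - q j) = p j * q j.
    by rewrite -[1 in X in X * _]s1 -[1 in X in _ * X]s1; ring.
  rewrite s2 -mulr2n -[LHS]mulr_natl.
  have -> : 1 - 4 * eps ^+ 2 = 2 ^+ 2 * (1 / 4 - eps ^+ 2) by field.
  by rewrite sqrtrM ?sqr_ge0// sqrtr_sqr ger0_norm.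
(* The [2 * m] coordinates of [S] give [(1 - 4 * eps ^+ 2) ^+ m], at least [1 - 4 * m * eps ^+ 2] by
   Bernoulli's inequality. *)
have rho34 : 3 / 4 <= rho.
  rewrite rhoE -big_mkcond /= prodr_const cardS exprM sqr_sqrtr; last by nra.
  apply: le_trans (@bernoulli_inequality _ m _); first by lra.
  by apply/andP; split; nra.
have pointwise w : m%:R * (Num.sqrt (table_weight p w * table_weight q w) -
    (table_weight p w + table_weight q w) / 4) <=
    table_weight p w * d1 w + table_weight q w * d0 w.
  have P0 := table_weight_ge0 w p01; have Q0 := table_weight_ge0 w q01.
  rewrite sqrtrM// -(dm w).
  have := sqr_sqrtr P0; have := sqr_sqrtr Q0.
  set a := Num.sqrt (table_weight p w); set b := Num.sqrt (table_weight q w).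
  move=> <- <-; have := d00 w; have := d10 w.
  set c := d0 w; set d := d1 w => d_ge0 c_ge0.
  have h1 := sqr_ge0 (a / 2 - b); have h2 := sqr_ge0 (a - b / 2).
  (* Weighting the two bounds by [d] and [c], whose sum is [m], gives the pointwise claim. *)
  have e1 : a * b - (a ^+ 2 + b ^+ 2) / 4 <= a ^+ 2 by nra.
  have e2 : a * b - (a ^+ 2 + b ^+ 2) / 4 <= b ^+ 2 by nra.
  have := ler_wpM2l d_ge0 e1; have := ler_wpM2l c_ge0 e2.
  by nra.
(* Both laws have mass 1, so the lower bound sums to [m * (rho - 1 / 2)]. *)
rewrite -big_split /=; apply: le_trans (ler_sum _ (fun w _ => pointwise w)).
rewrite -mulr_sumr sumrB -mulr_suml big_split /= !table_weight_sum1 -/rho.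
by nra.
Qed.

End finite_products.

(** * Bernoulli bandits *)

Section table_law.
Variables (R : realType) (J : finType) (q : J -> R).
Hypothesis q01 : forall j, 0 <= q j <= 1.
Implicit Types w : {ffun J -> bool}.

Definition decode_table (k : nat) : {ffun J -> bool} :=
  nth [ffun=> false] (enum {ffun J -> bool}) k.

(* The product of the Bernoulli laws [q j], carried by [nat] through an
   enumeration of the tables so as to use its discrete sigma-algebra. *)
Definition table_law : set nat -> \bar R :=
  msum (fun k => mscale (NngNum (table_weight_ge0 (decode_table k) q01)) \d_k)
    #|{ffun J -> bool}|.

HB.instance Definition _ := Measure.on table_law.

Lemma integral_table_law (g : {ffun J -> bool} -> R) : (forall w, 0 <= g w) ->
  (\int[table_law]_k (g (decode_table k))%:E =
   (\sum_w table_weight q w * g w)%:E)%E.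
Proof.
move=> g0; rewrite ge0_integral_measure_sum//=; last first.
  by move=> k _; rewrite lee_fin.
transitivity (\sum_(k < #|{ffun J -> bool}|)
    (table_weight q (decode_table k) * g (decode_table k))%:E)%E.
  apply: eq_bigr => k _.
  rewrite ge0_integral_mscale//=; last by move=> x _; rewrite lee_fin.
  by rewrite integral_dirac//= diracT mul1e.
rewrite sumEFin; congr EFin; rewrite [RHS]big_enum_val /=.
by apply: eq_bigr => k _; rewrite (enum_val_nth [ffun=> false]).
Qed.

Lemma table_lawE (Q : set {ffun J -> bool}) :
  table_law [set k | Q (decode_table k)] =
  (\sum_w table_weight q w * \1_Q w)%:E.
Proof.
rewrite -integral_table_law; last by move=> w; rewrite indicE.
transitivity (\int[table_law]_k (\1_[set k | Q (decode_table k)] k)%:E)%E.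
  by rewrite integral_indic// setIT.
by apply: eq_integral => k _.
Qed.

Let table_law_setT : table_law setT = 1%E.
Proof.
rewrite (_ : setT = [set k | [set: {ffun J -> bool}] (decode_table k)])//.
rewrite table_lawE.
rewrite -(table_weight_sum1 q); congr EFin.
by apply: eq_bigr => w _; rewrite indicT mulr1.
Qed.

HB.instance Definition _ :=
  @Measure_isProbability.Build _ _ R table_law table_law_setT.

Definition entry (j : J) (k : nat) : R := (decode_table k j)%:R.

Lemma measurable_entry j : measurable_fun setT (entry j).
Proof. by []. Qed.

Lemma table_law_bigcap (S : {set J}) (E : J -> set R) :
  table_law (\bigcap_(j in [set` S]) (entry j @^-1` E j)) =
  (\prod_(j in S) (q j * \1_(E j) 1 + (1 - q j) * \1_(E j) 0))%:E.
Proof.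
pose Q : set {ffun J -> bool} :=
  [set w : {ffun J -> bool} | forall j, j \in S -> E j (w j)%:R].
rewrite (_ : \bigcap_(j in _) _ = [set k | Q (decode_table k)])// table_lawE.
rewrite (eq_bigr (fun w : {ffun J -> bool} => table_weight q w *
    \prod_j (if j \in S then \1_(E j) (w j)%:R else 1))); last first.
  move=> w _; congr (_ * _); rewrite -big_mkcond /= indicE.
  have [wQ|wQ] := boolP (w \in Q).
    by rewrite big1// => j jS; rewrite indicE mem_set//; move/set_mem : wQ; exact.
  have /existsNP[j /not_implyP[jS jE]] : ~ Q w.
    by move=> /mem_set wQ'; rewrite wQ' in wQ.
  by rewrite (bigD1 j)//= indicE memNset// mul0r.
rewrite (sum_table_weight q (fun j v => if j \in S then \1_(E j) v%:R else 1)).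
rewrite [in RHS]big_mkcond; congr EFin; apply: eq_bigr => j _.
by case: ifP => // _; ring.
Qed.

Lemma table_law_entry (j : J) (E : set R) :
  table_law (entry j @^-1` E) = (q j * \1_E 1 + (1 - q j) * \1_E 0)%:E.
Proof.
have := table_law_bigcap [set j]%SET (fun=> E).
rewrite big_set1 => <-; congr table_law.
apply/seteqP; split=> k /= => [Ek j' /=|]; first by rewrite inE => /eqP ->.
by move=> /(_ j); apply; rewrite /= inE.
Qed.

End table_law.

Section bernoulli_bandit.
Variables (R : realType) (K T : nat) (mu : 'I_K -> R).
Hypotheses (T0 : (0 < T)%N) (mu01 : forall i, 0 <= mu i <= 1).

Let J : finType := ('I_K * 'I_T)%type.
Let bias (j : J) : R := mu j.1.
Let bias01 j : 0 <= bias j <= 1. Proof. exact: mu01. Qed.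

(** Rewards are indexed by all naturals but the table has [T] columns; indices beyond the horizon
    reuse column 0, and independence concerns only [n < T]. *)
Definition table_column (n : nat) : 'I_T := insubd (Ordinal T0) n.

Definition bernoulli_law : probability nat R := table_law bias01.

Definition bernoulli_reward (i : 'I_K) (n : nat) : {RV bernoulli_law >-> R} :=
  mfun_Sub (mem_set (measurable_entry (i, table_column n))).

Let reward_unit i n k : 0 <= bernoulli_reward i n k <= 1.
Proof.
have -> : bernoulli_reward i n k = entry R (i, table_column n) k by [].
by rewrite /entry; case: (decode_table J k _); rewrite ?lexx ?ler01.
Qed.

Let reward_mean i n : ('E_bernoulli_law[bernoulli_reward i n] = (mu i)%:E)%E.
Proof.
rewrite unlock /=.
rewrite (integral_table_law bias01 (g := fun w => (w (i, table_column n))%:R))//.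
rewrite (eq_bigr (fun w : {ffun J -> bool} => table_weight bias w *
    \prod_j (if j == (i, table_column n) then (w j)%:R else 1))); last first.
  by move=> w _; rewrite -big_mkcond big_pred1_eq.
rewrite (sum_table_weight bias
  (fun j v => if j == (i, table_column n) then v%:R else 1)).
rewrite (bigD1 (i, table_column n))//= eqxx big1 ?mulr1 ?mulr0 ?addr0//.
by move=> j /negPf ->; ring.
Qed.

Let reward_ident i m n (A : set R) : measurable A ->
  distribution bernoulli_law (bernoulli_reward i m) A =
  distribution bernoulli_law (bernoulli_reward i n) A.
Proof.
by move=> _; rewrite /distribution /pushforward /= !(table_law_entry bias01).
Qed.

Let reward_indep : mutually_independent
  (fun p : 'I_K * 'I_T => bernoulli_reward p.1 p.2).
Proof.
move=> S E mE.
have colE (p : J) : (p.1, table_column p.2) = p.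
  by case: p => i n; rewrite /table_column valKd.
transitivity (bernoulli_law (\bigcap_(p in [set` S]) (entry R p @^-1` E p))).
  by congr (bernoulli_law _); apply: eq_bigcapr => p _; rewrite /= colE.
apply: (etrans (table_law_bigcap bias01 S E)); rewrite -prodEFin.
apply: eq_bigr => p _; rewrite -(table_law_entry bias01).
by rewrite -{1}[p]colE.
Qed.

Definition bernoulli_bandit : bandit R K T :=
  Bandit reward_unit reward_mean reward_ident reward_indep.

Lemma integral_bernoulli_law (g : {ffun J -> bool} -> R) : (forall w, 0 <= g w) ->
  (\int[law bernoulli_bandit]_k (g (decode_table J k))%:E =
   (\sum_w table_weight (fun j : J => mu j.1) w * g w)%:E)%E.
Proof. exact: integral_table_law. Qed.

End bernoulli_bandit.

(** * The lower bound *)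

Section paired_instances.
Variables (R : realType) (B h : nat) (grp : 'I_B -> {set 'I_(2 * B + 1)}).
Variables (G : {set {set 'I_(2 * B + 1)}}).
Variables (f : 'I_B -> {set 'I_(2 * B + 1)} -> nat).
Hypotheses (B0 : (0 < B)%N) (h0 : (0 < h)%N) (h_even : ~~ odd h).
Hypothesis layout : paired_layout h grp G f.

Let K := (2 * B + 1)%N.
Let H := fun _ : 'I_B => h.
Let T := horizon H.
Let m := h./2.

Let hE : h = (m + m)%N. Proof. by rewrite addnn even_halfK. Qed.
Let m0 : (0 < m)%N. Proof. by move: h0; rewrite hE; lia. Qed.
Let TE : T = (B * h)%N. Proof. by rewrite /T /horizon sum_nat_const card_ord. Qed.
Let T0 : (0 < T)%N. Proof. by rewrite TE muln_gt0 B0. Qed.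
Let mT : (m <= T)%N.
Proof. by rewrite TE hE; apply: leq_trans (leq_addr _ _) (leq_pmull _ B0). Qed.

Lemma paired_arms : exists a : ('I_B -> 'I_K) * ('I_B -> 'I_K),
  forall b, a.1 b != a.2 b /\ grp b = [set a.1 b; a.2 b]%SET.
Proof.
case: layout => _ _ _ grp2 _.
have /choice[a aP] : forall b, exists p : 'I_K * 'I_K,
    p.1 != p.2 /\ grp b = [set p.1; p.2]%SET.
  move=> b; have /cards2P[i [j [ij ->]]] : #|grp b| == 2%N by rewrite grp2.
  by exists (i, j).
by exists (fst \o a, snd \o a).
Qed.

(** The groups cover at most [2 * B] of the [2 * B + 1] arms. *)
Lemma outside_arm : exists o : 'I_K, forall b, o \notin grp b.
Proof.
case: layout => grp_inj GE _ grp2 _.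
have ltK : (#|finset.cover G| < K)%N.
  apply: leq_ltn_trans (finset.leq_card_cover G) _.
  rewrite GE big_imset /=; last by move=> b c _ _; exact: grp_inj.
  by rewrite (eq_bigr (fun=> 2%N))// sum_nat_const card_ord /K mulnC addn1.
have [i iG] : exists i, i \notin finset.cover G.
  apply/existsP; apply: contraLR ltK; rewrite negb_exists => /forallP all_in.
  rewrite -leqNgt -[leqLHS](card_ord K); apply: subset_leq_card.
  by apply/fintype.subsetP => o _; have := all_in o; rewrite negbK.
exists i => b; apply: contra iG => ib; apply/finset.bigcupP.
by exists (grp b) => //; rewrite GE imset_f.
Qed.

Lemma grp_unique i b c : i \in grp b -> i \in grp c -> b = c.
Proof.
case: layout => grp_inj GE triv _ _ ib ic; apply: grp_inj; apply/eqP.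
apply: contraT => ne.
have bG : grp b \in G by rewrite GE imset_f.
have cG : grp c \in G by rewrite GE imset_f.
have /disjoint_setI0 := finset.trivIsetP triv _ _ bG cG ne.
by move/setP/(_ i); rewrite !inE ib ic.
Qed.

Variables (a : ('I_B -> 'I_K) * ('I_B -> 'I_K)) (o : 'I_K).
Hypothesis a_neq : forall b, a.1 b != a.2 b.
Hypothesis a_grp : forall b, grp b = [set a.1 b; a.2 b]%SET.
Hypothesis o_out : forall b, o \notin grp b.

(** The largest gap allowed by [two_point_bound]: [16 * m * eps ^+ 2 = 1]. *)
Let eps : R := 1 / (4 * Num.sqrt m%:R).

Let sqm_gt0 : 0 < Num.sqrt m%:R :> R. Proof. by rewrite sqrtr_gt0 ltr0n. Qed.
Let sqmE : Num.sqrt m%:R ^+ 2 = m%:R :> R. Proof. by rewrite sqr_sqrtr. Qed.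
Let eps_gt0 : 0 < eps. Proof. by rewrite divr_gt0 ?mulr_gt0. Qed.
Let eps_sq : 16 * m%:R * eps ^+ 2 = 1.
Proof. by rewrite -sqmE /eps; field; rewrite gt_eqF. Qed.
Let eps_m : eps * m%:R = Num.sqrt m%:R / 4.
Proof. by rewrite -[X in _ * X]sqmE /eps; field; rewrite gt_eqF. Qed.
Let eps_le : eps <= 1 / 4.
Proof.
rewrite /eps ler_pdivrMr ?mulr_gt0//.
have : 1 <= Num.sqrt m%:R :> R by rewrite -[leLHS](@sqrtr1 R) ler_wsqrtr// ler1n.
by lra.
Qed.

Implicit Types (sg : {ffun 'I_B -> bool}) (b : 'I_B).

(* Arms outside the groups have mean [1]; the sign [sg b] tells which of the two
   arms of group [b] has mean [1 / 2 + eps], the other having [1 / 2 - eps]. *)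
Definition paired_mean sg (i : 'I_K) : R :=
  if [pick b | i \in grp b] is Some b then
    if (i == a.1 b) == sg b then 1 / 2 + eps else 1 / 2 - eps
  else 1.

Definition good_arm sg b : 'I_K := if sg b then a.1 b else a.2 b.
Definition bad_arm sg b : 'I_K := if sg b then a.2 b else a.1 b.

Lemma paired_meanE sg b i : i \in grp b ->
  paired_mean sg i = if (i == a.1 b) == sg b then 1 / 2 + eps else 1 / 2 - eps.
Proof.
move=> ib; rewrite /paired_mean; case: pickP => [c ic|/(_ b)]; last by rewrite ib.
by rewrite (grp_unique ic ib).
Qed.

Lemma paired_mean_out sg : paired_mean sg o = 1.
Proof.
by rewrite /paired_mean; case: pickP => // b; rewrite (negPf (o_out b)).
Qed.

Lemma good_in sg b : good_arm sg b \in grp b.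
Proof. by rewrite a_grp /good_arm; case: (sg b); rewrite !inE eqxx ?orbT. Qed.

Lemma bad_in sg b : bad_arm sg b \in grp b.
Proof. by rewrite a_grp /bad_arm; case: (sg b); rewrite !inE eqxx ?orbT. Qed.

Lemma good_neq_bad sg b : good_arm sg b != bad_arm sg b.
Proof. by rewrite /good_arm /bad_arm; case: (sg b) => //; rewrite eq_sym. Qed.

Lemma good_or_bad sg b i : i \in grp b ->
  (i == good_arm sg b) || (i == bad_arm sg b).
Proof.
by rewrite a_grp !inE /good_arm /bad_arm; case: (sg b) => //; rewrite orbC.
Qed.

Lemma mean_good sg b : paired_mean sg (good_arm sg b) = 1 / 2 + eps.
Proof.
rewrite (paired_meanE _ (good_in sg b)) /good_arm; case: (sg b); first by rewrite !eqxx.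
by rewrite [a.2 b == _]eq_sym (negPf (a_neq b)).
Qed.

Lemma mean_bad sg b : paired_mean sg (bad_arm sg b) = 1 / 2 - eps.
Proof.
rewrite (paired_meanE _ (bad_in sg b)) /bad_arm; case: (sg b); last by rewrite !eqxx.
by rewrite [a.2 b == _]eq_sym (negPf (a_neq b)).
Qed.

Lemma paired_mean01 sg i : 0 <= paired_mean sg i <= 1.
Proof.
rewrite /paired_mean; case: pickP => [b _|_]; last by lra.
have := eps_gt0; have := eps_le; move: eps => e; case: ifP => _ e1 e2; lra.
Qed.

(** The witness splits each block equally between the good arm of its group and the outside arm [o],
    of mean 1; the other groups have floor 0 in that block. *)
Lemma paired_opt_ge sg :
  B%:R * (m%:R * (1 / 2 + eps) + m%:R) <= opt_frac H G f (paired_mean sg).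
Proof.
have -> : B%:R * (m%:R * (1 / 2 + eps) + m%:R) =
    \sum_(b < B) (m%:R * (1 / 2 + eps) + m%:R).
  by rewrite sumr_const card_ord mulr_natl.
apply: ler_sum => b _.
have go : (good_arm sg b == o) = false.
  by apply: contraNF (o_out b) => /eqP <-; exact: good_in.
pose y (i : 'I_K) : R :=
  if i == good_arm sg b then m%:R else if i == o then m%:R else 0.
have sumy (mu : 'I_K -> R) :
    \sum_(i < K) mu i * y i = mu (good_arm sg b) * m%:R + mu o * m%:R.
  rewrite (bigD1 (good_arm sg b))//= (bigD1 o)/=; last by rewrite eq_sym go.
  rewrite /y eqxx eq_sym go eqxx big1 ?addr0//.
  by move=> i /andP[/negPf -> /negPf ->]; rewrite mulr0.
have y_ge0 i : 0 <= y i by rewrite /y; case: ifP => // _; case: ifP.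
have yF : feasible H G f b y.
  case: layout => grp_inj GE _ _ fE; split=> // [g|].
    rewrite GE => /imsetP[c _ ->]; rewrite fE; case: ifPn => [/eqP/grp_inj ->|_].
      rewrite (bigD1 (good_arm sg b)) ?good_in//= {1}/y eqxx -/m lerDl.
      by apply: sumr_ge0 => i _; exact: y_ge0.
    by rewrite sumr_ge0.
  have := sumy (fun=> 1); rewrite !mul1r -natrD -hE => <-.
  by apply: eq_bigr => i _; rewrite mul1r.
have mu0 i : 0 <= paired_mean sg i by case/andP: (paired_mean01 sg i).
apply: le_trans (block_opt_ge mu0 yF).
by rewrite sumy mean_good paired_mean_out; lra.
Qed.

Let J : finType := ('I_K * 'I_T)%type.
Let table_of (w : {ffun J -> bool}) (i : 'I_K) (n : nat) : R :=
  (w (i, table_column T0 n))%:R.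
Let wgt sg (w : {ffun J -> bool}) : R :=
  table_weight (fun j : J => paired_mean sg j.1) w.

Let wgt_ge0 sg w : 0 <= wgt sg w.
Proof. by apply: table_weight_ge0 => j; exact: paired_mean01. Qed.

Section fair_run.
Variable pi : policy R K.
Hypothesis pi_fair : group_fair H G f pi.
Variable u : seed pi.

Section one_table.
Variable x : 'I_K -> nat -> R.
Hypothesis x_unit : unit_table x.

Let early b t := is_early u (grp b) m x t.
Let d b i := early_pulls u (grp b) m x i T.

(** The floor of block [b] alone already forces this many pulls. *)
Lemma group_pulls_ge b : (m <= group_pulls (grp b) (history u x T))%N.
Proof.
case: layout => grp_inj GE _ _ fE.
have := pi_fair u x_unit b (g := grp b).
rewrite fE eqxx GE imset_f// => /(_ isT) => /leq_trans; apply.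
under eq_bigr do rewrite block_countE.
rewrite exchange_big group_pulls_history /=; apply: leq_sum => t _.
have [Ab|nAb] := boolP (arm u x t \in grp b).
  rewrite (bigD1 (arm u x t))//= big1 ?addn0; first by case: (_ && _).
  by move=> i /andP[_ /negPf iA]; rewrite eq_sym iA andbF.
rewrite big1// => i ib; case: eqP => [Ai|_]; last by rewrite andbF.
by rewrite Ai ib in nAb.
Qed.

Lemma early_split sg b t :
  (early b t = early b t && (arm u x t == good_arm sg b)
     + (early b t && (arm u x t == bad_arm sg b)) :> nat)%N.
Proof.
rewrite /early /is_early; have [Ab|//] := boolP (arm u x t \in grp b).
have := good_or_bad sg Ab; have := good_neq_bad sg b.
case: (arm u x t =P good_arm sg b) => [->|_] /=.
  by move=> /negPf ->; rewrite andbT andbF addn0.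
by move=> _ ->; rewrite andbT andbF.
Qed.

Lemma sum_early b sg : (d b (good_arm sg b) + d b (bad_arm sg b) = m)%N.
Proof.
rewrite /d /early_pulls -big_split /=.
under eq_bigr do rewrite -early_split.
by rewrite sum_is_early; apply/minn_idPl; exact: group_pulls_ge.
Qed.

(** Losses are measured against mean 1: an early pull loses [1 / 2 - eps] on the good arm and
    [2 * eps] more on the bad one. The optimum accounts for [m * (1 / 2 - eps)] per group, and the
    excess remains. *)
Lemma paired_regret_ge sg :
  \sum_(b < B) 2 * eps * (d b (bad_arm sg b))%:R <=
  opt_frac H G f (paired_mean sg) - realized_value (paired_mean sg) T u x.
Proof.
set mu := paired_mean sg.
have mu_le1 i : mu i <= 1 by case/andP: (paired_mean01 sg i).
(* A round is early for at most one group, by disjointness, and every round has nonnegative loss. *)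
have one_group t : \sum_(b < B) (early b t)%:R * (1 - mu (arm u x t)) <=
    1 - mu (arm u x t).
  have [[b Ab]|nA] := pselect (exists b, arm u x t \in grp b); last first.
    rewrite big1 ?subr_ge0// => b _; rewrite /early /is_early.
    by have [Ab|] := boolP (_ \in grp b); [case: nA; exists b|rewrite mul0r].
  rewrite (bigD1 b)//= big1 ?addr0; last first.
    move=> c cb; rewrite /early /is_early.
    have [Ac|] := boolP (_ \in grp c); last by rewrite mul0r.
    by rewrite (grp_unique Ac Ab) eqxx in cb.
  by rewrite ler_piMl ?subr_ge0//; case: (early b t).
have per_group b : \sum_(t < T) (early b t)%:R * (1 - mu (arm u x t)) =
    m%:R * (1 / 2 - eps) + 2 * eps * (d b (bad_arm sg b))%:R.
  have -> : \sum_(t < T) (early b t)%:R * (1 - mu (arm u x t)) =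
    \sum_(t < T) ((early b t && (arm u x t == good_arm sg b))%:R * (1 / 2 - eps)
     + (early b t && (arm u x t == bad_arm sg b))%:R * (1 / 2 + eps)).
    apply: eq_bigr => t _; rewrite (early_split sg) natrD mulrDl; congr (_ + _).
      case: (arm u x t =P _) => [->|_]; last by rewrite andbF !mul0r.
      by rewrite /mu mean_good; congr (_ * _); lra.
    case: (arm u x t =P _) => [->|_]; last by rewrite andbF !mul0r.
    by rewrite /mu mean_bad; congr (_ * _); lra.
  rewrite big_split /= -!mulr_suml -!natr_sum -[X in _ = X%:R * _ + _](sum_early b sg).
  by rewrite natrD /d /early_pulls; ring.
have opt := paired_opt_ge sg; rewrite -/mu in opt.
have : \sum_(t < T) \sum_(b < B) (early b t)%:R * (1 - mu (arm u x t)) <=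
    \sum_(t < T) (1 - mu (arm u x t)) by apply: ler_sum.
rewrite exchange_big /= (eq_bigr _ (fun b _ => per_group b)) big_split /=.
rewrite sumr_const card_ord sumrB sumr_const card_ord.
rewrite -[X in X + _ <= _]mulr_natl -[X in _ <= X - _]/(T%:R) TE hE natrM natrD.
rewrite /realized_value -/T; lra.
Qed.

End one_table.
Let d b i (w : {ffun J -> bool}) : R :=
  (early_pulls u (grp b) m (table_of w) i T)%:R.

Let table_of_unit w : unit_table (table_of w).
Proof. by move=> i n; rewrite /table_of; case: (w _); rewrite ?lexx ?ler01. Qed.

(** No policy can be right under both signs of group [b]: an instance of [two_point_bound] on the
    first [m] entries of its two arms. *)
Lemma two_sided_early_pulls b sg : sg b ->
  m%:R / 4 <= \sum_w wgt sg w * d b (bad_arm sg b) w +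
              \sum_w wgt (flip_coordinate b sg) w * d b (bad_arm (flip_coordinate b sg) b) w.
Proof.
move=> sgb.
pose late : {set J} :=
  [set p : 'I_K * 'I_T | (p.1 \in grp b) && (m <= p.2)%N]%SET.
pose S : {set J} := finset.setX (grp b) [set n : 'I_T | (n < m)%N]%SET.
(* Early pulls ignore the late entries of the group, which may thus get the same bias under both
   signs; the two laws then differ only on [S]. *)
pose q sg' (p : J) : R := if p \in late then 1 / 2 else paired_mean sg' p.1.
have q01 sg' p : 0 <= q sg' p <= 1.
  by rewrite /q; case: ifP => _; [lra|exact: paired_mean01].
have d_late i (w w' : {ffun J -> bool}) :
    (forall p, p \notin late -> w p = w' p) -> d b i w = d b i w'.
  move=> ww'; rewrite /d; congr (_%:R); apply: early_pulls_agree => k n kn.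
  rewrite /table_of ww'// inE /=; have [kb|//] := boolP (k \in grp b).
  rewrite -ltnNge /table_column val_insubd (leq_trans (kn kb) mT).
  exact: kn.
have to_q sg' i : \sum_w wgt sg' w * d b i w =
    \sum_w table_weight (q sg') w * d b i w.
  apply: (table_weight_marginal (S := late)); last exact: d_late.
  by move=> p /negPf pl; rewrite /q pl.
have bad1 : bad_arm sg b = a.2 b by rewrite /bad_arm sgb.
have fb : flip_coordinate b sg b = false by rewrite ffunE eqxx sgb.
have bad2 : bad_arm (flip_coordinate b sg) b = a.1 b by rewrite /bad_arm fb.
have cardS : #|S| = (2 * m)%N.
  case: layout => _ _ _ grp2 _; rewrite finset.cardsX grp2; congr muln.
  rewrite -sum1_card; under eq_bigl do rewrite inE.
  by rewrite -(big_ord_widen _ (fun=> 1%N) mT) sum1_card card_ord.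
rewrite !to_q bad1 bad2.
apply: (@two_point_bound _ _ _ _ S eps) => //.
- move=> p pS; rewrite /q; case: ifPn => // pl.
  have pb : p.1 \notin grp b.
    apply: contra pl => pb; rewrite inE pb /= leqNgt.
    by move: pS; rewrite !inE pb.
  rewrite /paired_mean; case: pickP => // c pc; rewrite ffunE.
  by case: (eqVneq c b) pc => // ->; rewrite (negPf pb).
- move=> p; rewrite !inE => /andP[pb pm].
  have pl : (p \in late) = false by rewrite inE pb /= leqNgt pm.
  rewrite /q pl !(paired_meanE _ pb) fb sgb.
  by case: (p.1 == a.1 b) => /=; split; field.
- by rewrite eps_sq.
(* Flipping the sign exchanges good and bad arms, so the two error counts add up to [m]. *)
move=> w; rewrite /d -natrD; congr (_%:R).
have := sum_early (table_of_unit w) b sg; rewrite /bad_arm /good_arm sgb.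
by [].
Qed.

(** Each sign vector is paired with its flip at [b]; every vector is counted twice, which halves
    [m / 4]. *)
Lemma average_early_pulls b :
  #|{ffun 'I_B -> bool}|%:R * (m%:R / 8) <=
  \sum_sg \sum_w wgt sg w * d b (bad_arm sg b) w.
Proof.
set A := fun sg => \sum_w wgt sg w * d b (bad_arm sg b) w.
have pair sg : m%:R / 4 <= A sg + A (flip_coordinate b sg).
  have [sgb|nsgb] := boolP (sg b); first exact: two_sided_early_pulls.
  have fb : flip_coordinate b sg b by rewrite ffunE eqxx nsgb.
  by have := two_sided_early_pulls fb; rewrite flip_coordinateK addrC.
have : \sum_(sg : {ffun 'I_B -> bool}) (m%:R / 4) <=
    \sum_sg (A sg + A (flip_coordinate b sg)) by apply: ler_sum => sg _.
have -> : \sum_sg (A sg + A (flip_coordinate b sg)) = \sum_sg A sg + \sum_sg A sg.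
  by rewrite big_split; congr (_ + _); rewrite [RHS](reindex_inj (inv_inj (flip_coordinateK b))).
rewrite sumr_const -[X in X <= _]mulr_natl.
by rewrite -/A; lra.
Qed.

Lemma average_value_le :
  \sum_sg \sum_w wgt sg w * realized_value (paired_mean sg) T u (table_of w) <=
  \sum_sg opt_frac H G f (paired_mean sg) -
  #|{ffun 'I_B -> bool}|%:R * (B%:R * Num.sqrt m%:R / 16).
Proof.
have per_sign sg : \sum_(b < B) 2 * eps * (\sum_w wgt sg w * d b (bad_arm sg b) w)
    <= opt_frac H G f (paired_mean sg) -
       \sum_w wgt sg w * realized_value (paired_mean sg) T u (table_of w).
  have -> : opt_frac H G f (paired_mean sg) =
      \sum_w wgt sg w * opt_frac H G f (paired_mean sg).
    by rewrite -mulr_suml table_weight_sum1 mul1r.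
  rewrite -sumrB; under eq_bigr do rewrite mulr_sumr.
  rewrite exchange_big /=; apply: ler_sum => w _.
  rewrite -mulrBr; apply: le_trans (ler_wpM2l (wgt_ge0 sg w)
    (paired_regret_ge (table_of_unit w) sg)).
  by rewrite mulr_sumr le_eqVlt; apply/orP; left; apply/eqP;
    apply: eq_bigr => b _; rewrite mulrCA.
have := ler_sum (index_enum {ffun 'I_B -> bool}) (P := xpredT)
  (fun sg _ => per_sign sg).
rewrite sumrB exchange_big /= => h1.
have h2 : \sum_(b < B) 2 * eps * (#|{ffun 'I_B -> bool}|%:R * (m%:R / 8)) <=
    \sum_(b < B) \sum_sg 2 * eps * \sum_w wgt sg w * d b (bad_arm sg b) w.
  apply: ler_sum => b _; rewrite -mulr_sumr ler_wpM2l ?average_early_pulls//.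
  by rewrite mulr_ge0// ltW.
rewrite sumr_const card_ord -[X in X <= _]mulr_natl in h2.
(* The constant is [2 * eps * m / 8 = sqrt m / 16], by [eps * m = sqrt m / 4]. *)
have h3 : B%:R * (2 * eps * (#|{ffun 'I_B -> bool}|%:R * (m%:R / 8))) =
    #|{ffun 'I_B -> bool}|%:R * (B%:R * Num.sqrt m%:R / 16).
  rewrite (_ : 2 * eps * _ = #|{ffun 'I_B -> bool}|%:R * (eps * m%:R) / 4);
    last by field.
  by rewrite eps_m; field.
rewrite h3 in h2.
by lra.
Qed.

End fair_run.

(** * From a fixed seed to the expectation *)

Section expected_regret.
Variable pi : policy R K.
Hypothesis pi_fair : group_fair H G f pi.

Let value sg u w := realized_value (pi := pi) (paired_mean sg) T u (table_of w).

Definition paired_bandit sg : bandit R K T :=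
  bernoulli_bandit T0 (paired_mean01 sg).

Let E sg := ('E_(run_law (paired_bandit sg) pi)
  [run_value (M := paired_bandit sg) (pi := pi)])%E.

Let mean_ge0 sg i : 0 <= paired_mean sg i.
Proof. by case/andP: (paired_mean01 sg i). Qed.

Let value_ge0 sg u w : 0 <= value sg u w.
Proof. by apply: sumr_ge0 => t _; exact: mean_ge0. Qed.

Let average sg u := \sum_w wgt sg w * value sg u w.

Let average_ge0 sg u : 0 <= average sg u.
Proof. by apply: sumr_ge0 => w _; rewrite mulr_ge0. Qed.

Let run_valueE sg k u :
  run_value (M := paired_bandit sg) (pi := pi) (k, u) =
  value sg u (decode_table J k).
Proof. by []. Qed.

Let measurable_value sg w : measurable_fun setT (fun u => value sg u w).
Proof.
(* Every table has a code, so the map is a section of the jointly measurable run value. *)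
have wE : decode_table J (index w (enum {ffun J -> bool})) = w.
  by rewrite /decode_table nth_index// mem_enum.
rewrite -wE (_ : (fun u => _) = fun u => run_value (M := paired_bandit sg)
  (pi := pi) (index w (enum {ffun J -> bool}), u))//.
exact: measurableT_comp (@measurable_run_value R K T (paired_bandit sg) pi) _.
Qed.

Let measurable_average sg : measurable_fun setT (fun u => average sg u).
Proof. by apply: measurable_sum => w; exact: measurable_funM. Qed.

Lemma expected_valueE sg : E sg = (\int[seed_law pi]_u (average sg u)%:E)%E.
Proof.
rewrite /E unlock /run_law fubini_tonelli2; last 2 first.
- by apply/measurable_EFinP; exact: measurable_run_value.
- by move=> [k u]; rewrite lee_fin run_valueE.
apply: eq_integral => u _.
rewrite /fubini_G; under eq_integral do rewrite run_valueE.
exact: (@integral_bernoulli_law R K T (paired_mean sg) T0 (paired_mean01 sg)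
  (value sg u)).
Qed.

(** The bound averaged over signs holds for each seed, hence after integration over seeds; some sign
    vector then does at least as well as the average. *)
Lemma paired_lower_bound : ((B%:R * Num.sqrt m%:R / 16)%:E <=
  ereal_sup (range (fun sg => (opt_frac H G f (paired_mean sg))%:E - E sg)))%E.
Proof.
set r := _ / 16; set opt := fun sg => opt_frac H G f (paired_mean sg).
set N := #|{ffun 'I_B -> bool}|.
have sumE : (\sum_sg E sg <= (\sum_sg opt sg - N%:R * r)%:E)%E.
  under eq_bigr do rewrite expected_valueE.
  rewrite -ge0_integral_sum//; last 2 first.
  - by move=> sg; apply/measurable_EFinP.
  - by move=> sg u _; rewrite lee_fin.
  apply: (@le_trans _ _
    (\int[seed_law pi]_u (cst (\sum_sg opt sg - N%:R * r)%:E u))%E).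
    apply: ge0_le_integral => //.
    - by move=> u _; rewrite sume_ge0// => sg _; rewrite lee_fin.
    - by apply: emeasurable_sum => sg; apply/measurable_EFinP.
    - by move=> u _; rewrite sumEFin lee_fin; exact: average_value_le.
  by rewrite integral_cst// [X in (_ * X)%E]probability_setT mule1.
have E0 sg : (0 <= E sg)%E.
  by rewrite expected_valueE; apply: integral_ge0 => u _; rewrite lee_fin.
(* Finiteness allows the averaging contradiction to be carried out in the reals. *)
have Efin sg : E sg \is a fin_num.
  rewrite ge0_fin_numE//; apply: le_lt_trans (ltry (\sum_sg opt sg - N%:R * r)).
  by apply: le_trans sumE; rewrite (bigD1 sg)//= leeDl// sume_ge0.
rewrite leNgt; apply/negP => lt_r.
have gap sg : opt sg - fine (E sg) < r.
  rewrite -lte_fin EFinB fineK//; apply: le_lt_trans lt_r.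
  by apply: ereal_sup_ubound; exists sg.
have lt_sum : \sum_sg (opt sg - fine (E sg)) <
    \sum_(sg : {ffun 'I_B -> bool}) r.
  apply: ltr_sum => [|sg _]; last exact: gap.
  by apply/hasP; exists [ffun=> true]; rewrite ?mem_index_enum.
rewrite sumrB sumr_const -/N -[X in _ < X]mulr_natl in lt_sum.
move: sumE; rewrite (eq_bigr (fun sg => (fine (E sg))%:E)) => [|sg _];
  last by rewrite fineK.
rewrite sumEFin lee_fin.
by lra.
Qed.

End expected_regret.
End paired_instances.

(** * Assembly of the upper bound, its paired form and the lower bound *)

Theorem theorem9 (R : realType) :
  (forall (K B : nat) (H : 'I_B -> nat) (G : {set {set 'I_K}})
      (f : 'I_B -> {set 'I_K} -> nat) (eta : R)
      (s : nat -> option {set 'I_K}) (pi : policy R K),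
    let L := conf K H eta in
    (0 < K)%N ->
    (forall g, g \in G -> g != finset.set0) ->
    finset.trivIset G ->
    (forall b, (\sum_(g in G) f b g <= H b)%N) ->
    0 < eta < 1 ->
    dbdq_ucb H G f L s pi ->
    [/\ group_fair H G f pi,
        (* the covering pulls provide exactly [f b g] pulls for [g] *)
        (forall u x, unit_table x -> forall b g, g \in G ->
          block_count H b
            (fun t => (s t != None) && (arm (pi := pi) u x t \in g)) = f b g),
        (forall M : bandit R K (horizon H),
          ((1 - eta)%R%:E <=
           run_law M pi [set z | (opt_frac H G f (mean M) - run_value z
                                  <= group_bound H G f L)%R])%E),
        group_bound H G f L <= coarse_bound K H L
      & (* singleton groups *)
        ((forall g, g \in G -> #|g| = 1%N) ->
         forall M : bandit R K (horizon H),
         (forall istar, (forall i, mean M i <= mean M istar) ->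
            opt_frac H G f (mean M) = comparator_value H G f (mean M) istar) /\
         ((1 - eta)%R%:E <=
          run_law M pi [set z | (opt_frac H G f (mean M) - run_value z
                                 <= singleton_bound H G f L)%R])%E)]) /\
  (* paired layouts: the bound, and the matching lower bound *)
  (exists2 C : R, 0 < C &
    forall (B h : nat) (grp : 'I_B -> {set 'I_(2 * B + 1)})
      (G : {set {set 'I_(2 * B + 1)}})
      (f : 'I_B -> {set 'I_(2 * B + 1)} -> nat) (eta : R),
    let H := fun _ : 'I_B => h in
    let L := conf (2 * B + 1) H eta in
    (0 < B)%N -> (0 < h)%N -> ~~ odd h -> paired_layout h grp G f ->
    0 < eta < 1 ->
    group_bound H G f L <= C * (Num.sqrt L * B%:R * Num.sqrt h%:R) /\
    coarse_bound (2 * B + 1) H L <= C * (Num.sqrt L * B%:R * Num.sqrt h%:R)) /\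
  (exists2 c : R, 0 < c &
    forall (B h : nat) (grp : 'I_B -> {set 'I_(2 * B + 1)})
      (G : {set {set 'I_(2 * B + 1)}})
      (f : 'I_B -> {set 'I_(2 * B + 1)} -> nat),
    let H := fun _ : 'I_B => h in
    (0 < B)%N -> (0 < h)%N -> ~~ odd h -> paired_layout h grp G f ->
    exists (I : Type) (M : I -> bandit R (2 * B + 1) (horizon H)),
    forall pi : policy R (2 * B + 1), group_fair H G f pi ->
    ((c * B%:R * Num.sqrt h%:R)%R%:E <=
     ereal_sup (range (fun i => (opt_frac H G f (mean (M i)))%:E
                   - 'E_(run_law (M i) pi)[run_value (M := M i) (pi := pi)])))%E).
Proof.
split; [|split].
- move=> K B H G f eta s pi L K0 G_nonempty G_trivial floors_fit eta01 pi_ucb.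
  have L_ge0 : 0 <= L by exact: conf_ge0.
  have L_gt0 : (0 < horizon H)%N -> 0 < L.
    by move=> T0; apply: lt_le_trans (conf_ge_half K0 eta01 T0).
  have mean01 (M : bandit R K (horizon H)) i : 0 <= mean M i <= 1.
    apply: (unit_expectation_bounds (X := reward M i 0)); last exact: reward_mean.
    exact: reward_unit.
  have table_unit (M : bandit R K (horizon H)) w :
    unit_table (fun i n => reward M i n w) by move=> i n; exact: reward_unit.
  split.
  + by move=> u x x_unit b g gG; exact: floor_met pi_ucb _ _ x_unit _ _ gG.
  + by move=> u x x_unit b g gG; exact: covering_count pi_ucb _ _ x_unit _ _ gG.
  + move=> M; apply: (run_law_ge L_gt0 (conf_failure H K0 eta01)) => z zc.
    exact: (group_regret K0 G_nonempty G_trivial floors_fit pi_ucb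
      z.2 (table_unit M z.1) (mean01 M) L_ge0 zc).
  + exact: group_bound_le_coarse.
  move=> G1 M; split.
    move=> istar istar_max; apply: opt_frac_comparator => // i.
    by case/andP: (mean01 M i).
  apply: (run_law_ge L_gt0 (conf_failure H K0 eta01)) => z zc.
  exact: (singleton_regret K0 G_nonempty G_trivial floors_fit pi_ucb
    z.2 (table_unit M z.1) (mean01 M) L_ge0 zc G1).
- exists 40 => // B h grp G f eta H L B0 h0 h_even layout eta01.
  have T0 : (0 < horizon H)%N.
    by rewrite /horizon sum_nat_const card_ord muln_gt0 B0.
  have K0 : (0 < 2 * B + 1)%N by rewrite addn1.
  have coarse := coarse_bound_paired B0 h0 (conf_ge_half K0 eta01 T0).
  split; last exact: coarse.
  apply: le_trans coarse; apply: group_bound_le_coarse; first by case: layout.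
  exact: paired_floors_fit layout.
exists (1 / 32) => [|B h grp G f H B0 h0 h_even layout]; first by rewrite divr_gt0.
have [a aP] := paired_arms layout; have [top topP] := outside_arm layout.
have a_neq b : a.1 b != a.2 b by case: (aP b).
have a_grp b : grp b = [set a.1 b; a.2 b]%SET by case: (aP b).
(* The family of sign vectors is fixed before the policy; only the worst sign depends on it. *)
exists {ffun 'I_B -> bool}, (fun sg => paired_bandit R grp B0 h0 h_even a sg).
move=> pi pi_fair.
apply: le_trans (paired_lower_bound B0 h0 h_even layout a_neq a_grp topP pi_fair).
rewrite lee_fin.
(* Passing from [h./2] to [h] at the cost of a factor 2 turns [1 / 16] into [1 / 32]. *)
have h_le : Num.sqrt h%:R <= 2 * Num.sqrt (h./2)%:R :> R.
  rewrite -[X in X * _]ger0_norm// -sqrtr_sqr -sqrtrM ?sqr_ge0// ler_wsqrtr//.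
  by rewrite -natrX -natrM ler_nat; have := even_halfK h_even; lia.
have : B%:R * Num.sqrt h%:R <= B%:R * (2 * Num.sqrt (h./2)%:R) :> R.
  by rewrite ler_wpM2l.
by lra.
Qed.
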